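(* Let $\{f_\theta : \theta\in\Theta\}$, $\Theta\subset\mathbb{R}^p$, be a parametric family of densities on $\mathbb{R}^d$ with Fisher information $I(\theta)$, and let $\theta_0\in\Theta$. Let $X_1,\ldots,X_n$ be i.i.d. from $f_{\theta_0}$. Suppose that $\hat\theta(\underline X)$ is an efficient estimator which is locally asymptotically equivariant (LAE) at $\theta_0$. Sample $Z_1,\ldots,Z_n$ so that, conditionally on $\hat\theta(\underline X)$, they are i.i.d. from $f_{\hat\theta(\underline X)}$. Then 1. $\sqrt n\{\hat\theta(\underline Z)-\theta_0\}\overset{d}{\rightarrow} N\{0,2I^{-1}(\theta_0)\}$, whereas $\sqrt n\{\hat\theta(\underline X)-\theta_0\}\overset{d}{\rightarrow} N\{0,I^{-1}(\theta_0)\}$; and 2. $\mathrm{TV}\{(X_1,\ldots,X_n),(Z_1,\ldots,Z_n)\}$ does not converge to zero as $n\to\infty$.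
   Context: Notation: $\underline X=(X_1,\ldots,X_n)$, $\underline Z=(Z_1,\ldots,Z_n)$. The score function is $S(\theta,x)=\nabla_\theta\log f_\theta(x)$ and the Fisher information is $I(\theta)=E_\theta\{S(\theta,X)S^\top(\theta,X)\}$, where $E_\theta$ is expectation under $X\sim f_\theta$. An estimator (for each $n$) $\hat\theta:\mathbb{R}^{d\times n}\to\Theta$ is efficient for $\theta$ if, for $X_1,\ldots,X_n$ i.i.d. from $f_\theta$, $\sqrt n\{\hat\theta(\underline X)-\theta\}\overset{d}{\rightarrow}N\{0,I^{-1}(\theta)\}$. Local asymptotic equivariance: let $H_n(\theta)$ be the distribution of $\sqrt n(\hat\theta(\underline X)-\theta)$ when $X_1,\ldots,X_n$ are i.i.d. from $f_\theta$, assumed to converge (in distribution) to $H(\theta)$ as $n\to\infty$. The estimator $\hat\theta$ is locally asymptotically equivariant (LAE) at $\theta_0\in\Theta$ if for every convergent sequence $h_n\to h$ we have $H_n(\theta_0+h_n/\sqrt n)\to H(\theta_0)$. $\mathrm{TV}$ denotes the total variation distance between the (marginal) joint distributions of the two random vectors; the distribution of $(Z_1,\ldots,Z_n)$ is its marginal distribution, with the randomness of $\hat\theta(\underline X)$ integrated out. *)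

(* Defs.v *)
From HB Require Import structures.
From mathcomp Require Import all_boot all_order all_algebra.
From mathcomp Require Import all_classical all_reals all_analysis.
From mathcomp Require Import measurable_realfun.

Set Implicit Arguments.
Unset Strict Implicit.
Unset Printing Implicit Defensive.

Import Order.TTheory GRing.Theory Num.Theory.
Import numFieldNormedType.Exports.

Local Open Scope classical_set_scope.
Local Open Scope ring_scope.

Definition measure_mx_display : measure_display -> measure_display.
Proof. exact. Qed.

(* The product sigma-algebra on matrices, generated by the entries; on 'rV[R]_n
   with R real this is the Borel sigma-algebra of R^n. *)
Section measurable_mx.
Context {d} {T : measurableType d} (m n : nat).

Definition mx_cylinders : set (set 'M[T]_(m, n)) :=
  [set B | exists i j, preimage_set_system setT 
    (fun M : 'M[T]_(m, n) => M i j) measurable B].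

Let mx_set0 : <<s mx_cylinders >> set0.
Proof. exact: sigma_algebra0. Qed.

Let mx_setC A : <<s mx_cylinders >> A -> <<s mx_cylinders >> (~` A).
Proof. exact: sigma_algebraC. Qed.

Let mx_bigcup (F : (set 'M[T]_(m, n))^nat) :
  (forall i, <<s mx_cylinders >> (F i)) -> <<s mx_cylinders >> (\bigcup_i F i).
Proof. exact: sigma_algebra_bigcup. Qed.

HB.instance Definition _ := @isMeasurable.Build (measure_mx_display d)
  'M[T]_(m, n) <<s mx_cylinders >> mx_set0 mx_setC mx_bigcup.

End measurable_mx.

Lemma measurable_mx_entry d (T : measurableType d) m n i j :
  measurable_fun [set: 'M[T]_(m, n)] (fun M => M i j).
Proof.
move=> _ Y mY; apply: sub_sigma_algebra; exists i, j.
by exists Y.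
Qed.

Lemma measurable_fun_mxP d d' (S : measurableType d) (T : measurableType d')
    m n (f : S -> 'M[T]_(m, n)) :
  (forall i j, measurable_fun setT (fun s => f s i j)) -> measurable_fun setT f.
Proof.
move=> mf _ A; rewrite setTI; move: A; apply: smallest_sub.
  split=> /=; first by rewrite preimage_set0.
    by move=> A mA; rewrite setTD preimage_setC; exact: measurableC.
  by move=> F mF; rewrite preimage_bigcup; exact: bigcup_measurable.
move=> _ [i [j [B mB <-]]] /=; rewrite setTI.
by rewrite -[X in measurable X]setTI; exact: mf.
Qed.

(* The library's pushforward, with a measure structure inferred from {mfun S >-> T}
   (as distribution does when mu is a probability). *)
Definition image_measure d d' (S : measurableType d) (T : measurableType d')
    (R : realType) (mu : {measure set S -> \bar R}) (f : {mfun S >-> T}) :=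
  pushforward mu f.

Section image_measure.
Context d d' (S : measurableType d) (T : measurableType d') (R : realType).
Variables (mu : {measure set S -> \bar R}) (f : {mfun S >-> T}).

Let image0 : image_measure mu f set0 = 0%E.
Proof. by rewrite /image_measure /pushforward preimage_set0 measure0. Qed.

Let image_ge0 A : (0 <= image_measure mu f A)%E.
Proof. exact: measure_ge0. Qed.

Let image_sigma_additive : semi_sigma_additive (image_measure mu f).
Proof.
move=> F mF tF mUF; rewrite /image_measure /pushforward preimage_bigcup.
apply: measure_semi_sigma_additive.
- by move=> n; rewrite -[X in measurable X]setTI; exact: measurable_funPT.
- apply/trivIsetP => /= i j _ _ ij; rewrite -preimage_setI.
  by move/trivIsetP : tF => /(_ _ _ _ _ ij) ->//; rewrite preimage_set0.
- by rewrite -preimage_bigcup -[X in measurable X]setTI; exact: measurable_funPT.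
Qed.

HB.instance Definition _ := isMeasure.Build _ _ _ (image_measure mu f)
  image0 image_ge0 image_sigma_additive.

End image_measure.

Lemma image_measure_sigma_finite d d' (S : measurableType d)
    (T : measurableType d') (R : realType)
    (mu : {measure set S -> \bar R}) (f : {mfun S >-> T}) (g : T -> S) :
  sigma_finite setT mu ->
  measurable_fun setT g -> cancel f g -> sigma_finite setT (image_measure mu f).
Proof.
move=> [F TF Foo] mg fK.
exists (fun i => g @^-1` F i) => [|i].
  by rewrite -preimage_bigcup -TF.
have [mF muF] := Foo i; split.
  by rewrite -[X in measurable X]setTI; exact: mg.
rewrite /image_measure /pushforward -comp_preimage.
rewrite (_ : g \o f = id) ?preimage_id//.
by apply/funext => x /=; exact: fK.
Qed.

Lemma product_measure1_sigma_finite d d' (S : measurableType d)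
    (T : measurableType d') (R : realType)
    (mu : {sigma_finite_measure set S -> \bar R})
    (nu : {sigma_finite_measure set T -> \bar R}) :
  sigma_finite setT (mu \x nu)%E.
Proof.
have /sigma_finiteP[F [TF ndF Foo]] := sigma_finiteT mu.
have /sigma_finiteP[G [TG ndG Goo]] := sigma_finiteT nu.
exists (fun n => F n `*` G n).
  rewrite -setXTT TF TG predeqE => -[x y]; split.
    move=> [/= [n _ Fnx] [k _ Gky]]; exists (maxn n k) => //; split.
    - by move: x Fnx; exact/subsetPset/ndF/leq_maxl.
    - by move: y Gky; exact/subsetPset/ndG/leq_maxr.
  by move=> [n _ []/= ? ?]; split; exists n.
move=> k; have [? ?] := Foo k; have [? ?] := Goo k.
split; first exact: measurableX.
by rewrite product_measure1E// lte_mul_pinfty// ge0_fin_numE.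
Qed.

Section power_measure.
Context d (T : measurableType d) (R : realType).

Section cons.
Variable n : nat.

Definition tuple_cons (xt : T * n.-tuple T) : n.+1.-tuple T :=
  [tuple of xt.1 :: xt.2].

Let mtuple_cons : measurable_fun setT tuple_cons.
Proof. exact: measurable_cons. Qed.

HB.instance Definition _ := isMeasurableFun.Build _ _ _ _ tuple_cons mtuple_cons.

Definition tuple_uncons (t : n.+1.-tuple T) : T * n.-tuple T :=
  (thead t, [tuple of behead t]).

Lemma measurable_tuple_uncons : measurable_fun setT tuple_uncons.
Proof.
apply/measurable_fun_pairP; split.
  exact: (measurable_tnth ord0).
exact: measurable_behead.
Qed.

Lemma tuple_consK : cancel tuple_cons tuple_uncons.
Proof.
by case=> x t; rewrite /tuple_uncons /tuple_cons /=; congr pair; exact/val_inj.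
Qed.

Variables (mu : {sigma_finite_measure set T -> \bar R})
  (nu : {sigma_finite_measure set (n.-tuple T) -> \bar R}).

Definition cons_measure := image_measure (mu \x nu)%E tuple_cons.

HB.instance Definition _ := Measure.on cons_measure.

Let cons_measure_sigma_finite : sigma_finite setT cons_measure.
Proof.
apply: image_measure_sigma_finite measurable_tuple_uncons tuple_consK.
exact: product_measure1_sigma_finite.
Qed.

HB.instance Definition _ :=
  Measure_isSigmaFinite.Build _ _ _ cons_measure cons_measure_sigma_finite.

End cons.

(* The n-fold product of mu with itself. *)
Fixpoint power_measure (mu : {sigma_finite_measure set T -> \bar R}) (n : nat) :
    {sigma_finite_measure set (n.-tuple T) -> \bar R} :=
  if n is m.+1 then cons_measure mu (power_measure mu m) else \d_[tuple].

End power_measure.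

Section lebesgue_rV.
Context (R : realType) (n : nat).

Definition rV_of_tuple (t : n.-tuple (measurableTypeR R)) : 'rV[R]_n := \row_i tnth t i.

Let mrV_of_tuple : measurable_fun setT rV_of_tuple.
Proof.
apply: measurable_fun_mxP => i j; under eq_fun do rewrite mxE.
exact: measurable_tnth.
Qed.

HB.instance Definition _ :=
  isMeasurableFun.Build _ _ _ _ rV_of_tuple mrV_of_tuple.

Definition tuple_of_rV (v : 'rV[R]_n) : n.-tuple (measurableTypeR R) := [tuple v ord0 i | i < n].

Lemma measurable_tuple_of_rV : measurable_fun setT tuple_of_rV.
Proof.
apply/measurable_fun_tnthP => i.
rewrite (_ : _ \o _ = fun v : 'rV[R]_n => v ord0 i).
  exact: measurable_mx_entry.
by apply/funext => v /=; rewrite tnth_mktuple.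
Qed.

Lemma rV_of_tupleK : cancel rV_of_tuple tuple_of_rV.
Proof. by move=> t; apply: eq_from_tnth => i; rewrite tnth_mktuple mxE. Qed.

Definition lebesgue_rV : set 'rV[R]_n -> \bar R :=
  image_measure (power_measure (@lebesgue_measure R) n) rV_of_tuple.

HB.instance Definition _ := Measure.on lebesgue_rV.

Let lebesgue_rV_sigma_finite : sigma_finite setT lebesgue_rV.
Proof.
apply: image_measure_sigma_finite measurable_tuple_of_rV rV_of_tupleK.
exact: sigma_finiteT.
Qed.

HB.instance Definition _ :=
  Measure_isSigmaFinite.Build _ _ _ lebesgue_rV lebesgue_rV_sigma_finite.

End lebesgue_rV.

Section density_laws.
Context (R : realType) (d : nat).

Definition is_density (g : 'rV[R]_d -> R) : Prop :=
  [/\ measurable_fun setT g, (forall x, 0 <= g x)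
    & (\int[@lebesgue_rV R d]_x (g x)%:E = 1)%E].

Section density_measure.
Variables (g : 'rV[R]_d -> R).
Hypotheses (mg : measurable_fun setT g) (g_ge0 : forall x, 0 <= g x).

Definition density_measure (A : set 'rV[R]_d) : \bar R :=
  (\int[@lebesgue_rV R d]_(x in A) (g x)%:E)%E.

Lemma density_measure0 : density_measure set0 = 0%E.
Proof. by rewrite /density_measure integral_set0. Qed.

Lemma density_measure_ge0 A : (0 <= density_measure A)%E.
Proof. by apply: integral_ge0 => x _; rewrite lee_fin. Qed.

Lemma density_measure_sigma_additive : semi_sigma_additive density_measure.
Proof.
move=> /= A mA tA mUA; rewrite /density_measure ge0_integral_bigcup//=.
- by apply: is_cvg_ereal_nneg_natsum_cond => n _ _; exact: density_measure_ge0.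
- by apply/measurable_EFinP; exact: measurable_funTS.
- by move=> x _; rewrite lee_fin.
Qed.

End density_measure.

Definition density_prob_of (g : 'rV[R]_d -> R) (hg : is_density g) :
  set 'rV[R]_d -> \bar R := density_measure g.

Section density_prob_of.
Variables (g : 'rV[R]_d -> R) (hg : is_density g).

Let mg : measurable_fun setT g. Proof. by case: hg. Qed.
Let g_ge0 x : 0 <= g x. Proof. by case: hg. Qed.

HB.instance Definition _ := isMeasure.Build _ _ _ (density_prob_of hg)
  (density_measure0 g) (density_measure_ge0 g_ge0)
  (density_measure_sigma_additive mg g_ge0).

Let density_prob_of_setT : density_prob_of hg setT = 1%E.
Proof. by case: hg. Qed.

HB.instance Definition _ := Measure_isProbability.Build _ _ _
  (density_prob_of hg) density_prob_of_setT.

End density_prob_of.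

(* The law with Lebesgue density g; a Dirac mass if g is not a density. *)
Definition density_prob (g : 'rV[R]_d -> R) : probability 'rV[R]_d R :=
  if pselect (is_density g) is left hg then density_prob_of hg else \d_(0 : 'rV[R]_d).

Lemma density_probE (g : 'rV[R]_d -> R) (A : set 'rV[R]_d) : is_density g ->
  density_prob g A = (\int[@lebesgue_rV R d]_(x in A) (g x)%:E)%E.
Proof. by move=> hg; rewrite /density_prob; case: pselect. Qed.

(* The joint law of n i.i.d. draws from the density g. *)
Definition iid_law (n : nat) (g : 'rV[R]_d -> R) :
    {sigma_finite_measure set (n.-tuple 'rV[R]_d) -> \bar R} :=
  power_measure (density_prob g) n.

End density_laws.

Section normal.
Context (R : realType) (n : nat) (m : 'rV[R]_n) (S : 'M[R]_n).

Definition normal_rV_pdf (x : 'rV[R]_n) : R :=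
  (Num.sqrt ((2 * pi) ^+ n * \det S))^-1 *
  expR (- ((x - m) *m invmx S *m (x - m)^T) ord0 ord0 / 2).

Lemma normal_rV_pdf_ge0 x : 0 <= normal_rV_pdf x.
Proof. by rewrite mulr_ge0 ?invr_ge0 ?sqrtr_ge0 ?expR_ge0. Qed.

Lemma measurable_normal_rV_pdf : measurable_fun setT normal_rV_pdf.
Proof.
apply: measurable_funM => //; apply: measurableT_comp => //.
apply: measurable_funM => //; apply: measurableT_comp => //.
have mentry i : measurable_fun setT (fun x : 'rV[R]_n => (x - m) ord0 i).
  under eq_fun do rewrite mxE.
  by apply: measurable_funD => //; exact: measurable_mx_entry.
under eq_fun do rewrite mxE.
apply: measurable_sum => j; apply: measurable_funM.
  under eq_fun do rewrite mxE.
  by apply: measurable_sum => k; exact: measurable_funM.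
by under eq_fun do rewrite mxE; exact: mentry.
Qed.

(* The (nondegenerate) normal law N(m, S), given by its density. *)
Definition normal_rV : set 'rV[R]_n -> \bar R := density_measure normal_rV_pdf.

HB.instance Definition _ := isMeasure.Build _ _ _ normal_rV
  (density_measure0 normal_rV_pdf) (density_measure_ge0 normal_rV_pdf_ge0)
  (density_measure_sigma_additive measurable_normal_rV_pdf normal_rV_pdf_ge0).

End normal.

(* Convergence in distribution of the random vectors Y n, each defined on its own
   space, to the law nu. *)
Definition cvg_in_dist (R : realType) (k : nat) (dT : measure_display)
    (T : nat -> measurableType dT) (P : forall n, {measure set (T n) -> \bar R})
    (Y : forall n, T n -> 'rV[R]_k) (nu : {measure set 'rV[R]_k -> \bar R}) :=
  forall g : 'rV[R]_k -> R, continuous g -> bounded_fun g ->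
    \int[P n]_w g (Y n w) @[n --> \oo] --> \int[nu]_y g y.

Section parametric_estimation.
Context (R : realType) (d p : nat).
Variables (Theta : set 'rV[R]_p) (f : 'rV[R]_p -> 'rV[R]_d -> R).
Variable est : forall n : nat, n.-tuple 'rV[R]_d -> 'rV[R]_p.
Implicit Types theta : 'rV[R]_p.

Definition log_lik (x : 'rV[R]_d) theta : R := ln (f theta x).

Definition score theta (x : 'rV[R]_d) : 'rV[R]_p :=
  \row_j 'D_(delta_mx ord0 j) (log_lik x) theta.

(* Scores are row vectors, so this is the (i, j) entry of the column-vector
   product S S^T. *)
Definition score_prod theta (i j : 'I_p) (x : 'rV[R]_d) : R :=
  ((score theta x)^T *m score theta x) i j.

Definition fisher theta : 'M[R]_p :=
  \matrix_(i, j) fine 'E_(density_prob (f theta))[score_prod theta i j].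

(* Existence of a finite, invertible Fisher information. The partial derivatives
   are those of f as a function on the whole parameter space; when theta is
   interior to Theta they depend only on the densities of the family. *)
Definition has_fisher theta : Prop :=
  let P := density_prob (f theta) in
  [/\ {ae P, forall x, forall j : 'I_p,
         derivable (log_lik x) theta (delta_mx ord0 j)},
      (forall i j, P.-integrable setT (EFin \o score_prod theta i j))
    & fisher theta \in unitmx].

Definition estimator : Prop :=
  forall n, measurable_fun setT (@est n) /\ forall x, Theta (@est n x).

Definition scaled_error n theta (x : n.-tuple 'rV[R]_d) : 'rV[R]_p :=
  Num.sqrt n%:R *: (est x - theta).

Definition efficient theta : Prop :=
  cvg_in_dist (fun n => iid_law n (f theta))
    (fun n => @scaled_error n theta) (normal_rV 0 (invmx (fisher theta))).

(* H is the limit law H(theta0) of the scaled errors at theta0. The local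
   parameters need only be in Theta eventually; when theta0 is interior to Theta
   this holds for every convergent sequence h_. *)
Definition lae theta0 : Prop :=
  exists2 H : probability 'rV[R]_p R,
    cvg_in_dist (fun n => iid_law n (f theta0))
      (fun n => @scaled_error n theta0) H
  & forall (h_ : nat -> 'rV[R]_p) (h : 'rV[R]_p), h_ n @[n --> \oo] --> h ->
      let theta_ n := theta0 + (Num.sqrt n%:R)^-1 *: h_ n in
      (\forall n \near \oo, Theta (theta_ n)) ->
      cvg_in_dist (fun n => iid_law n (f (theta_ n)))
        (fun n => @scaled_error n (theta_ n)) H.

End parametric_estimation.

Section sampling.
Context (R : realType) (d p : nat) (dO : measure_display)
  (Omega : measurableType dO) (P : probability Omega R) (n : nat).

Definition iid_sample (X : Omega -> n.-tuple 'rV[R]_d) (g : 'rV[R]_d -> R) :=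
  forall A, measurable A -> P (X @^-1` A) = iid_law n g A.

(* w |-> iid_law n (f (T w)) is a regular conditional distribution of Z given
   the sigma-algebra generated by T. *)
Definition cond_iid_sample (f : 'rV[R]_p -> 'rV[R]_d -> R)
    (T : Omega -> 'rV[R]_p) (Z : Omega -> n.-tuple 'rV[R]_d) :=
  forall A, measurable A ->
    measurable_fun (setT : set (g_sigma_algebra_preimageType T))
      (fun w => iid_law n (f (T w)) A) /\
    forall B, measurable B ->
      P (T @^-1` B `&` Z @^-1` A) =
      (\int[P]_(w in T @^-1` B) iid_law n (f (T w)) A)%E.

End sampling.

Definition tv_dist (R : realType) d (T : measurableType d)
    (mu nu : set T -> \bar R) : \bar R :=
  ereal_sup [set `|mu A - nu A|%E | A in measurable].

(* Main.v *)
Require Import Defs.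
From HB Require Import structures.
From mathcomp Require Import all_boot all_order all_algebra.
From mathcomp Require Import all_classical all_reals all_analysis.
From mathcomp Require Import measurable_realfun ring lra.

Set Implicit Arguments.
Unset Strict Implicit.
Unset Printing Implicit Defensive.

Import Order.TTheory GRing.Theory Num.Theory.
Import numFieldNormedType.Exports.

Local Open Scope classical_set_scope.
Local Open Scope ring_scope.

(** Write S for the inverse of the Fisher information at theta0 and U_n for the
    scaled error of the estimator on the original sample; by efficiency U_n
    converges in law to N(0, S). Given the original sample, the new sample is drawn
    from the density with parameter theta0 + U_n / sqrt n, so the error of the
    estimator on the new sample splits into U_n and the error relative to the
    parameter that generated the sample. Equivariance says that the
    latter has asymptotic law N(0, S) whatever the local parameter, so it is
    asymptotically independent of U_n, and the sum has the law of the sum of two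
    independent N(0, S) vectors, that is N(0, 2S).

    To make this rigorous, fix a bounded continuous test function g and let Phi_n(v)
    be the conditional mean of g at the new scaled error given U_n = v
    ([local_mean]). The law of the new sample is a mixture, so the mean of g under it
    is the mean of Phi_n(U_n) ([cond_iid_sample_Rintegral]). Equivariance gives
    Phi_n(v_n) --> Phi(u) as v_n --> u, where Phi(u) is the mean of g(Y + u) for Y
    with law N(0, S). This is a statement about sequences of admissible parameters;
    it is upgraded to local uniformity in [local_mean_cvg_locally], which uses that
    admissible local parameters are asymptotically dense. The extended continuous
    mapping theorem ([cvg_integral_continuous_mapping]) then gives convergence of
    the mean of Phi_n(U_n) to the mean of Phi under N(0, S), and this is the mean of
    g under N(0, 2S) by [normal_rV_convolution].

    The two samples cannot be close in total variation: applying the estimator to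
    both does not increase the distance, and the limit laws N(0, S) and N(0, 2S) give
    different masses to a ball. The masses are compared through continuous
    cutoffs ([cutoff_gap_le_tv], [cutoff_normal_rV_lt]). *)

(** * Lebesgue measure under homotheties and translations *)

Section affine.
Context (R : realType).
Local Open Scope ereal_scope.

(** The image of Lebesgue measure by an increasing affine map, rescaled by its
    slope, agrees with Lebesgue measure on half-open intervals, hence
    everywhere. *)
Lemma lebesgue_integral_affine (s a : R) (F : measurableTypeR R -> \bar R) :
  (0 < s)%R -> measurable_fun setT F -> (forall x, 0 <= F x) ->
  \int[@lebesgue_measure R]_x F (s * x + a)%R =
  (s^-1)%:E * \int[@lebesgue_measure R]_x F x.
Proof.
move=> s0 mF F0.
pose T (x : measurableTypeR R) : measurableTypeR R := (s * x + a)%R.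
have mT : measurable_fun setT T.
  by apply: measurable_funD => //; apply: measurable_funM.
pose T' : {mfun measurableTypeR R >-> measurableTypeR R} :=
  HB.pack T (isMeasurableFun.Build _ _ _ _ _ mT).
have s0' : (0 <= s)%R := ltW s0.
pose m := mscale (NngNum s0') (image_measure (@lebesgue_measure R) T').
have mE A : measurable A -> lebesgue_measure A = m A.
  move: A; apply: lebesgue_measure_unique => _ [[u v] _ <-].
  change (lebesgue_measure `]u, v]%classic =
    s%:E * lebesgue_measure (T @^-1` `]u, v]%classic)).
  have -> : T @^-1` `]u, v]%classic = `]((u - a) / s)%R, ((v - a) / s)%R]%classic.
    apply/seteqP; split => x /=; rewrite !in_itv /= ltr_pdivrMr// ler_pdivlMr//;
      by rewrite /T ltrBlDr lerBrDr (mulrC x).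
  rewrite !lebesgue_measure_itv/= !lte_fin ltr_pM2r ?invr_gt0// ltrD2r.
  case: ifPn => _; last by rewrite mule0.
  by rewrite -!EFinD -EFinM; congr EFin; field; rewrite gt_eqF.
rewrite [X in _ * X](eq_measure_integral m) => [|A mA _]; last exact: mE.
rewrite ge0_integral_mscale// muleA -EFinM mulVf ?gt_eqF// mul1e.
by rewrite ge0_integral_pushforward.
Qed.

Lemma integral_power_measureS d (T : measurableType d)
    (mu : {sigma_finite_measure set T -> \bar R}) n
    (F : n.+1.-tuple T -> \bar R) :
  measurable_fun setT F -> (forall t, 0 <= F t) ->
  \int[power_measure mu n.+1]_t F t =
  \int[mu]_x \int[power_measure mu n]_t F (tuple_cons (x, t)).
Proof.
move=> mF F0; rewrite /= ge0_integral_pushforward// fubini_tonelli1// => [|x].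
  by apply: measurableT_comp => //; exact: measurable_funPT.
exact: F0.
Qed.

Lemma measurable_tuple_affine n (s : R) (a : 'I_n -> R) :
  measurable_fun setT (fun t : n.-tuple (measurableTypeR R) =>
    [tuple (s * tnth t i + a i)%R | i < n] : n.-tuple (measurableTypeR R)).
Proof.
apply/measurable_fun_tnthP => i.
under [X in measurable_fun _ X]eq_fun do rewrite /= tnth_mktuple.
apply: measurable_funD => //; apply: measurable_funM => //.
exact: measurable_tnth.
Qed.

(** Fubini reduces dimension [n.+1] to dimension [n], one factor [s^-1] being
    produced per coordinate. *)
Lemma power_lebesgue_integral_affine n (s : R) (a : 'I_n -> R)
    (F : n.-tuple (measurableTypeR R) -> \bar R) :
  (0 < s)%R -> measurable_fun setT F -> (forall x, 0 <= F x) ->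
  \int[power_measure (@lebesgue_measure R) n]_t
     F [tuple (s * tnth t i + a i)%R | i < n] =
  (s ^- n)%:E * \int[power_measure (@lebesgue_measure R) n]_t F t.
Proof.
move=> s0; elim: n a F => [|n IH] a F mF F0.
  rewrite expr0 invr1 mul1e; apply: eq_integral => t _; congr F.
  by apply: eq_from_tnth => -[].
have mFc : measurable_fun setT (F \o @tuple_cons _ (measurableTypeR R) n).
  by apply: measurableT_comp => //; exact: measurable_funPT.
rewrite !integral_power_measureS//; last first.
  exact: measurableT_comp mF (measurable_tuple_affine s a).
pose K x := \int[power_measure (@lebesgue_measure R) n]_t F (tuple_cons (x, t)).
have mK : measurable_fun setT K := measurable_fun_fubini_tonelli_F _ mFc
  (fun=> F0 _).
transitivity (\int[@lebesgue_measure R]_x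
    ((s ^- n)%:E * K (s * x + a ord0)%R)).
  apply: eq_integral => x _.
  rewrite /K -(IH (a \o lift ord0)) => [|//|]; last 2 first.
  - exact: measurableT_comp mFc (measurable_pair1 _).
  - by move=> t; exact: F0.
  apply: eq_integral => t _; congr F; apply: eq_from_tnth => i.
  rewrite tnth_mktuple; case: (unliftP ord0 i) => [j ->|->] /=.
    by rewrite !tnthS tnth_mktuple.
  by rewrite !tnth0.
rewrite ge0_integralZl; [|by []| | |].
- rewrite lebesgue_integral_affine// => [|x].
    by rewrite muleA -EFinM exprSr invfM mulrC.
  exact: integral_ge0.
- apply: measurableT_comp mK _.
  by apply: measurable_funD => //; exact: measurable_funM.
- by move=> x _; exact: integral_ge0.
- by rewrite lee_fin invr_ge0 exprn_ge0// ltW.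
Qed.

Lemma lebesgue_rV_integral_affine n (s : R) (a : 'rV[R]_n)
    (F : 'rV[R]_n -> \bar R) :
  (0 < s)%R -> measurable_fun setT F -> (forall x, 0 <= F x) ->
  \int[@lebesgue_rV R n]_x F (s *: x + a)%R =
  (s ^- n)%:E * \int[@lebesgue_rV R n]_x F x.
Proof.
move=> s0 mF F0.
have pushE G : measurable_fun setT G -> (forall x, 0 <= G x) ->
    \int[@lebesgue_rV R n]_x G x =
    \int[power_measure (@lebesgue_measure R) n]_t G (rV_of_tuple t).
  by move=> mG G0; rewrite [LHS]ge0_integral_pushforward.
rewrite !pushE//; last first.
  apply: measurableT_comp => //; apply: measurable_fun_mxP => i j.
  under eq_fun do rewrite !mxE.
  apply: measurable_funD => //; apply: measurable_funM => //.
  exact: measurable_mx_entry.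
rewrite -(power_lebesgue_integral_affine (a ord0)) => [|//||//]; last first.
  by apply: measurableT_comp => //; exact: measurable_funPT.
apply: eq_integral => t _; congr F.
by apply/rowP => i; rewrite !mxE tnth_mktuple.
Qed.
End affine.

(** * Mixtures of measures, densities and Borel measurability *)

Section mixture.
Context d1 d2 (X : measurableType d1) (Y : measurableType d2) (R : realType).
Variables (nu : {measure set X -> \bar R}) (mu : {measure set Y -> \bar R})
  (k : X -> {measure set Y -> \bar R}).
Hypothesis mk : forall A, measurable A -> measurable_fun setT (k ^~ A).
Hypothesis muE : forall A, measurable A -> mu A = (\int[nu]_x k x A)%E.
Local Open Scope ereal_scope.
Import HBNNSimple.

Let integral_mixture_nnsfun (f : {nnsfun Y >-> R}) :
  \int[mu]_y (f y)%:E = \int[nu]_x \int[k x]_y (f y)%:E.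
Proof.
have fE (m : {measure set Y -> \bar R}) : \int[m]_y (f y)%:E =
    \sum_(r \in range f) (r%:E * m (f @^-1` [set r])).
  by rewrite integralT_nnsfun sintegralE.
rewrite fE; under [RHS]eq_integral do rewrite fE.
rewrite ge0_integral_fsum//=.
- apply: eq_fsbigr => r /[!inE] -[y _ <-].
  rewrite muE// ge0_integralZl ?lee_fin//.
  exact: mk.
- by move=> r; apply: measurable_funeM; exact: mk.
- move=> r x _.
  have [r0|r0] := leP 0%R r; first by rewrite mule_ge0.
  by rewrite preimage_nnfun0// measure0 mule0.
Qed.

(** Both sides are linear and monotonically continuous in [h], so that the
    identity on indicators extends to simple and then nonnegative functions. The
    lemma serves for conditional laws, for densities (mixtures of rescaled Dirac
    masses) and for image measures (mixtures of Dirac masses). *)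
Lemma integral_mixture (h : Y -> \bar R) :
  measurable_fun setT h -> (forall y, 0 <= h y) ->
  \int[mu]_y h y = \int[nu]_x \int[k x]_y h y.
Proof.
move=> mh h0; pose h_ := nnsfun_approx measurableT mh.
have h_lim (m : {measure set Y -> \bar R}) :
    \int[m]_y h y = limn (fun n => \int[m]_y (h_ n y)%:E).
  rewrite -monotone_convergence//=.
  - by apply: eq_integral => y _; apply/esym/cvg_lim => //; exact: cvg_nnsfun_approx.
  - by move=> n; exact/measurable_EFinP.
  - by move=> n y _; rewrite lee_fin.
  - by move=> y _ a b ab; rewrite lee_fin; exact/lefP/nd_nnsfun_approx.
rewrite h_lim; under [RHS]eq_integral do rewrite h_lim.
under [in LHS]eq_fun do rewrite integral_mixture_nnsfun.
rewrite monotone_convergence//.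
- move=> n; apply: measurable_fun_integral_kernel => //.
    by move=> y; rewrite lee_fin.
  exact/measurable_EFinP.
- by move=> n x _; apply: integral_ge0 => y _; rewrite lee_fin.
- move=> x _ a b ab; apply: ge0_le_integral => //.
  + by move=> y _; rewrite lee_fin.
  + exact/measurable_EFinP.
  + exact/measurable_EFinP.
  + by move=> y _; rewrite lee_fin; exact/lefP/nd_nnsfun_approx.
Qed.

End mixture.

Section density.
Context (R : realType) (n : nat).
Local Open Scope ereal_scope.

Lemma integral_density_measure (g : 'rV[R]_n -> R)
    (nu : {measure set 'rV[R]_n -> \bar R}) (h : 'rV[R]_n -> \bar R) :
  measurable_fun setT g -> (forall x, 0 <= g x)%R ->
  (forall A, measurable A -> nu A = density_measure g A) ->
  measurable_fun setT h -> (forall x, 0 <= h x) ->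
  \int[nu]_x h x = \int[@lebesgue_rV R n]_x ((g x)%:E * h x).
Proof.
move=> mg g0 nuE mh h0.
pose k (x : 'rV[R]_n) : {measure set 'rV[R]_n -> \bar R} :=
  mscale (NngNum (g0 x)) (\d_x).
rewrite (@integral_mixture _ _ _ _ _ (@lebesgue_rV R n) nu k) => [|A mA|A mA|//|//].
- apply: eq_integral => x _.
  by rewrite ge0_integral_mscale//= integral_dirac// diracT mul1e.
- apply: emeasurable_funM; first exact/measurable_EFinP.
  by rewrite /dirac/=; apply/measurable_EFinP; exact: measurable_indic.
- rewrite nuE// /density_measure [LHS]integral_mkcond; apply: eq_integral => x _.
  rewrite /k /= /mscale/= diracE patchE.
  by case: (x \in A); rewrite ?mule1 ?mule0.
Qed.
End density.

Section borel.
Context (R : realType) (n : nat).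

Lemma measurable_ball_rV (x : 'rV[R]_n) (e : R) : 0 < e -> measurable (ball x e).
Proof.
move=> e0.
have -> : ball x e = \bigcap_(i in [set: 'I_n])
    (fun y : 'rV[R]_n => y ord0 i) @^-1` (ball (x ord0 i) e).
  apply/seteqP; split => [y [_ xy] i _|y xy]; first exact: xy.
  by split=> // i j; rewrite ord1; exact: xy.
apply: fin_bigcap_measurable => // i _.
rewrite -[X in measurable X]setTI; apply: measurable_mx_entry => //.
exact: measurable_ball.
Qed.

(** An open set is the countable union of the balls with rational centre and
    inverse integer radius that it contains; for the norm of ['rV[R]_n] balls are
    boxes, so they belong to the sigma-algebra generated by the entries. *)
Lemma open_measurable_rV (O : set 'rV[R]_n) : open O -> measurable O.
Proof.
move=> oO.
pose B (qk : 'rV[rat]_n * nat) : set 'rV[R]_n :=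
  ball (map_mx (@ratr R) qk.1 : 'rV[R]_n) (qk.2.+1%:R^-1).
have -> : O = \bigcup_(qk in [set qk | B qk `<=` O]) B qk.
  apply/seteqP; split => [x Ox|x [qk]]; last exact.
  have /nbhs_ballP[e /= e0 xeO] : nbhs x O by apply: open_nbhs_nbhs.
  have [k ke] : exists k, k.+1%:R^-1 < e / 2.
    have : \forall k \near \oo, k.+1%:R^-1 < e / 2.
      by apply: near_infty_natSinv_lt (PosNum (divr_gt0 e0 _)) => //.
    by move=> /(filter_ex).
  have k0 : 0 < k.+1%:R^-1 :> R by [].
  have /(choice) [q qx] : forall i, exists q : rat,
      `|x ord0 i - ratr q| < k.+1%:R^-1.
    move=> i.
    have [q] : exists q, ratr q \in `]x ord0 i - k.+1%:R^-1, x ord0 i + k.+1%:R^-1[.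
      by apply: rat_in_itvoo; rewrite ltrD2l (lt_trans _ k0)// oppr_lt0.
    by rewrite in_itv/= => xq; exists q; rewrite ltr_distlC.
  exists (\row_i q i, k); last first.
    by split=> // i j; rewrite !mxE ord1 /ball/= distrC.
  move=> y [_ qy]; apply: xeO; split=> // i j.
  have := qy i j; rewrite !mxE ord1 /ball/= => qyj.
  rewrite (le_lt_trans (ler_distD (ratr (q j)) _ _))//.
  by rewrite [e]splitr (lt_trans (ltrD (qx j) qyj))// ltrD.
rewrite bigcup_mkcond; apply: countable_bigcupT_measurable => [|qk].
  exact: countableP.
by case: ifPn => // _; exact: measurable_ball_rV.
Qed.

Lemma continuous_measurable_rV (g : 'rV[R]_n -> R) :
  continuous g -> measurable_fun setT g.
Proof.
move=> /continuousP cg; apply: (measurability _ (RGenOpens.measurableE R)).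
move=> _ [_ [a [b ->] <-]]; rewrite setTI.
by apply: open_measurable_rV; exact/cg/interval_open.
Qed.
End borel.

(** * The normal law: dilation, convolution, support *)

Section normal_law.
Context (R : realType) (n : nat) (S : 'M[R]_n).
Hypothesis S_unit : S \in unitmx.
Local Open Scope ereal_scope.
Notation lambda := (@lebesgue_rV R n).
Notation N := (normal_rV 0 S).
Notation N2 := (normal_rV 0 (2 *: S)%R).
Notation phi := (normal_rV_pdf 0 S).
Notation phi2 := (normal_rV_pdf 0 (2 *: S)%R).
Notation s2 := (Num.sqrt 2%R : R).
Implicit Types h : 'rV[R]_n -> \bar R.

Lemma integral_normal_rV (m : 'rV[R]_n) (V : 'M[R]_n) h :
  measurable_fun setT h -> (forall x, 0 <= h x) ->
  \int[normal_rV m V]_x h x =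
  \int[lambda]_x ((normal_rV_pdf m V x)%:E * h x).
Proof.
move=> mh h0; apply: integral_density_measure => //.
  exact: measurable_normal_rV_pdf.
exact: normal_rV_pdf_ge0.
Qed.

Lemma measurable_rV_affine (s : R) (a : 'rV[R]_n) :
  measurable_fun setT (fun x : 'rV[R]_n => (s *: x + a)%R).
Proof.
apply: measurable_fun_mxP => i j; under eq_fun do rewrite !mxE.
apply: measurable_funD => //; apply: measurable_funM => //.
exact: measurable_mx_entry.
Qed.

Let qf (x : 'rV[R]_n) : R := ((x *m invmx S *m x^T) ord0 ord0)%R.

Let sqr_s2 : (s2 ^+ 2 = 2 :> R)%R.
Proof. by rewrite sqr_sqrtr. Qed.

Let s2_gt0 : (0 < s2)%R.
Proof. by rewrite sqrtr_gt0. Qed.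

Let qfZ (a : R) x : qf (a *: x) = (a ^+ 2 * qf x)%R.
Proof.
by rewrite /qf linearZ/= -!scalemxAl -scalemxAr !mxE mulrA expr2.
Qed.

(** The identity behind the stability of the normal law under convolution: it
    is completion of the square in [u], with the square centred at [y / 2]. *)
Let qf_parallelogram (u y : 'rV[R]_n) :
  (qf u + qf (y - u) = qf y / 2 + 2 * qf (u - 2^-1 *: y))%R.
Proof.
pose b (v w : 'rV[R]_n) : R := ((v *m invmx S *m w^T) ord0 ord0)%R.
have bBl v w z : b (v - w)%R z = (b v z - b w z)%R.
  by rewrite /b !mulmxBl !mxE.
have bBr v w z : b z (v - w)%R = (b z v - b z w)%R.
  by rewrite /b linearB/= mulmxBr !mxE.
have bZl a v w : b (a *: v)%R w = (a * b v w)%R.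
  by rewrite /b -!scalemxAl mxE.
have bZr a v w : b v (a *: w)%R = (a * b v w)%R.
  by rewrite /b linearZ/= -scalemxAr mxE.
change (b u u + b (y - u) (y - u) =
  b y y / 2 + 2 * b (u - 2^-1 *: y) (u - 2^-1 *: y))%R.
by rewrite !(bBl, bBr, bZl, bZr); field.
Qed.

Let phiE x : phi x =
  ((Num.sqrt ((2 * pi) ^+ n * \det S))^-1 * expR (- qf x / 2))%R.
Proof. by rewrite /normal_rV_pdf subr0. Qed.

Let phi2E x : phi2 x = (s2 ^- n *
  (Num.sqrt ((2 * pi) ^+ n * \det S))^-1 * expR (- qf x / 4))%R.
Proof.
have s2X : (2 ^+ n = (s2 ^+ n) ^+ 2 :> R)%R by rewrite -exprM mulnC exprM sqr_s2.
rewrite /normal_rV_pdf subr0 invmxZ ?unitmxZ ?unitfE// detZ mulrCA s2X.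
rewrite sqrtrM ?sqr_ge0// sqrtr_sqr.
rewrite ger0_norm ?exprn_ge0 ?ltW// invfM; congr (_ * expR _)%R.
by rewrite -scalemxAr -scalemxAl mxE -/(qf x); field.
Qed.

(** The law of [sqrt 2] times a N(0, S) vector is N(0, 2S), at the level of
    densities. *)
Let phi_scale x : phi x = (s2 ^+ n * phi2 (s2 *: x))%R.
Proof.
rewrite phi2E phiE qfZ sqr_s2 !mulrA mulfV ?expf_neq0 ?gt_eqF// mul1r.
by congr (_ * expR _)%R; field.
Qed.

(** As a function of [u], the integrand of the convolution of the density of
    N(0, S) with itself is again a copy of that density, dilated and
    translated; the value of its integral is thus known without computing any
    Gaussian integral. *)
Let phi_convolution u y :
  (phi u * phi (y - u) = s2 ^+ n * phi2 y * phi (s2 *: u - (s2 / 2) *: y))%R.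
Proof.
have -> : (s2 *: u - (s2 / 2) *: y = s2 *: (u - 2^-1 *: y))%R.
  by rewrite scalerBr scalerA.
rewrite phi2E !phiE qfZ sqr_s2; set k := (Num.sqrt _)^-1%R.
have s2X : (s2 ^+ n != 0)%R by rewrite expf_neq0 ?gt_eqF.
transitivity (k * k * (expR (- qf y / 4) *
    expR (- (2 * qf (u - 2^-1 *: y)) / 2)))%R; last by field.
rewrite mulrACA -!expRD; congr (_ * expR _)%R.
have := qf_parallelogram u y; lra.
Qed.

Lemma normal_rV_scale h : measurable_fun setT h -> (forall x, 0 <= h x) ->
  \int[N2]_x h x = \int[N]_x h (s2 *: x)%R.
Proof.
move=> mh h0; have mphi2 := measurable_normal_rV_pdf (0 : 'rV[R]_n) (2 *: S).
have mh2 : measurable_fun setT (fun x : 'rV[R]_n => h (s2 *: x)%R).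
  apply: measurableT_comp => //.
  by have := measurable_rV_affine s2 0; under eq_fun do rewrite addr0.
rewrite [LHS]integral_normal_rV; [|by []..].
rewrite [RHS]integral_normal_rV; [|by []..].
pose F x := (phi2 x)%:E * h x.
transitivity (\int[lambda]_x ((s2 ^+ n)%:E * F (s2 *: x + 0)%R)); last first.
  by apply: eq_integral => x _; rewrite /F addr0 muleA -EFinM -phi_scale.
have mF : measurable_fun setT F.
  by apply: emeasurable_funM => //; exact/measurable_EFinP.
have F0 x : 0 <= F x by rewrite mule_ge0// lee_fin normal_rV_pdf_ge0.
rewrite ge0_integralZl; [|by []| |by []|by rewrite lee_fin exprn_ge0// ltW];
  last exact: measurableT_comp mF (measurable_rV_affine _ _).
rewrite (lebesgue_rV_integral_affine 0 s2_gt0)// muleA -EFinM.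
by rewrite mulfV ?mul1e// expf_neq0 ?gt_eqF.
Qed.

Hypothesis N1 : N setT = 1.

Let int_phi : \int[lambda]_x (phi x)%:E = 1.
Proof. exact: N1. Qed.

Let measurable_phi : measurable_fun setT (EFin \o phi).
Proof. by apply/measurable_EFinP; exact: measurable_normal_rV_pdf. Qed.

Let measurable_sub :
  measurable_fun setT (fun z : 'rV[R]_n * 'rV[R]_n => (z.2 - z.1)%R).
Proof.
apply: measurable_fun_mxP => i j; under eq_fun do rewrite !mxE.
apply: measurable_funB; apply: measurableT_comp (@measurable_mx_entry _ _ _ _ i j) _;
  [exact: measurable_snd|exact: measurable_fst].
Qed.

(** The sum of two independent N(0, S) vectors is N(0, 2S). *)
Lemma normal_rV_convolution h : measurable_fun setT h -> (forall x, 0 <= h x) ->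
  \int[N]_u \int[N]_y h (y + u)%R = \int[N2]_y h y.
Proof.
move=> mh h0.
pose G (z : 'rV[R]_n * 'rV[R]_n) := (phi (z.2 - z.1)%R)%:E * h z.2.
have mG : measurable_fun setT G.
  apply: emeasurable_funM; last exact: measurableT_comp mh measurable_snd.
  exact: measurableT_comp measurable_phi measurable_sub.
have G0 z : 0 <= G z by rewrite mule_ge0// lee_fin normal_rV_pdf_ge0.
have shiftE u : \int[N]_y h (y + u)%R = \int[lambda]_y G (u, y).
  have mhu : measurable_fun setT (fun y : 'rV[R]_n => h (y + u)%R).
    apply: measurableT_comp => //.
    by have := measurable_rV_affine 1 u; under eq_fun do rewrite scale1r.
  rewrite integral_normal_rV; [|exact: mhu|by []].
  have := @lebesgue_rV_integral_affine _ _ 1%R u (fun y => G (u, y)) ltr01.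
  rewrite expr1n invr1 mul1e => <-;
    [|exact: measurableT_comp mG (measurable_pair1 _)|by []].
  by apply: eq_integral => y _; rewrite /G/= scale1r addrK.
transitivity (\int[N]_u \int[lambda]_y G (u, y)).
  by apply: eq_integral => u _; exact: shiftE.
rewrite [RHS]integral_normal_rV; [|by []..].
rewrite [LHS]integral_normal_rV; last 2 first.
- exact: measurable_fun_fubini_tonelli_F.
- by move=> u; exact: integral_ge0.
pose K (z : 'rV[R]_n * 'rV[R]_n) := (phi z.1)%:E * G z.
have mK : measurable_fun setT K.
  by apply: emeasurable_funM => //;
    exact: measurableT_comp measurable_phi measurable_fst.
have K0 z : 0 <= K z by rewrite mule_ge0// lee_fin normal_rV_pdf_ge0.
transitivity (\int[lambda]_u \int[lambda]_y K (u, y)).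
  apply: eq_integral => u _; rewrite -ge0_integralZl; [by []|by []| |by []|].
  - exact: measurableT_comp mG (measurable_pair1 _).
  - by rewrite lee_fin normal_rV_pdf_ge0.
rewrite (fubini_tonelli K); [|by []..]; apply: eq_integral => y _.
pose c := ((s2 ^+ n * phi2 y)%:E * h y).
transitivity (\int[lambda]_u (c * (phi (s2 *: u + - ((s2 / 2) *: y))%R)%:E)).
  apply: eq_integral => u _.
  by rewrite /K /G/= muleA -EFinM phi_convolution EFinM muleAC.
have c0 : 0 <= c.
  by rewrite mule_ge0// lee_fin mulr_ge0 ?exprn_ge0 ?normal_rV_pdf_ge0// ltW.
rewrite ge0_integralZl; [|by []| | |exact: c0]; last 2 first.
- exact: measurableT_comp measurable_phi (measurable_rV_affine _ _).
- by move=> u _; rewrite lee_fin normal_rV_pdf_ge0.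
rewrite (lebesgue_rV_integral_affine _ s2_gt0 measurable_phi); last first.
  by move=> u; rewrite lee_fin normal_rV_pdf_ge0.
rewrite [X in _ * (_ * X)]int_phi mule1 /c muleAC -EFinM mulrAC.
by rewrite mulfV ?mul1r// expf_neq0 ?gt_eqF.
Qed.

(** If the integral vanished, Lebesgue measure would vanish on a ball, because
    the normal density is everywhere positive; by affine invariance it would then
    vanish on all balls, and the normal law would be null. *)
Lemma normal_rV_support (g : 'rV[R]_n -> R) (u : 'rV[R]_n) :
  continuous g -> (forall x, 0 <= g x)%R -> (0 < g u)%R ->
  0 < \int[N]_x (g x)%:E.
Proof.
move=> cg g0 gu; have mg := continuous_measurable_rV cg.
rewrite lt0e integral_ge0 ?andbT => [|x _]; last by rewrite lee_fin.
apply/eqP; rewrite integral_normal_rV; last 2 first.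
- exact/measurable_EFinP.
- by move=> x; rewrite lee_fin.
have phi_gt0 x : (0 < phi x)%R.
  rewrite lt0r normal_rV_pdf_ge0 andbT phiE mulf_neq0//; last first.
    by rewrite gt_eqF ?expR_gt0.
  apply/eqP => k0; move: int_phi; rewrite integral0_eq => [|z _].
    by move/eqP; rewrite eqe eq_sym oner_eq0.
  by rewrite phiE k0 mul0r.
move=> int0.
have ae0 : ae_eq lambda setT (fun x => (phi x)%:E * (g x)%:E) (cst 0).
  apply/ae_eq_integral_abs => //.
    by apply: emeasurable_funM => //; exact/measurable_EFinP.
  rewrite -[RHS]int0; apply: eq_integral => x _.
  by rewrite gee0_abs// -EFinM lee_fin mulr_ge0// ltW.
have /nbhs_ballP[r /= r0 urg] : \forall x \near u, (0 < g x)%R.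
  exact: (cvgr_gt _ (cg u)).
have ball0 : lambda (ball u r) = 0.
  apply: (measure_negligible (measurable_ball_rV u r0)).
  apply: negligibleS ae0 => x xr /= /(_ I)/eqP.
  by rewrite -EFinM eqe mulf_eq0 !gt_eqF ?urg.
have int_indicE A : measurable A -> \int[lambda]_x (\1_A x)%:E = lambda A.
  by move=> mA; rewrite integral_indic// setIT.
have ballE (k : R) : (0 < k)%R -> lambda (ball 0%R k) = 0.
  move=> k0; have s0 : (0 < r / k)%R by rewrite divr_gt0.
  have mb := measurable_ball_rV u r0.
  have preE : (fun x : 'rV[R]_n => (r / k) *: x + u)%R @^-1` ball u r = ball 0%R k.
    apply/seteqP; split=> x; rewrite -!ball_normE /ball_ /= sub0r normrN;
      by rewrite opprD addrCA subrr addr0 normrN normrZ gtr0_norm// mulrAC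
        ltr_pdivrMr// ltr_pM2l.
  have mb1 : measurable_fun setT (EFin \o \1_(ball u r) : 'rV[R]_n -> \bar R).
    exact/measurable_EFinP/measurable_indic.
  have b0 (x : 'rV[R]_n) : 0 <= (EFin \o (\1_(ball u r) : _ -> R)) x.
    by rewrite /= lee_fin.
  have := lebesgue_rV_integral_affine u s0 mb1 b0.
  rewrite [X in _ * X](int_indicE _ mb) ball0 mule0 => <-.
  rewrite -int_indicE; last exact: measurable_ball_rV.
  rewrite -preE; apply: eq_integral => x _.
  rewrite /comp; congr EFin; rewrite !indicE; congr ((nat_of_bool _)%:R).
have lambda0 : lambda setT = 0.
  have -> : [set: 'rV[R]_n] = \bigcup_k ball (0 : 'rV[R]_n)%R k.+1%:R.
    apply/seteqP; split=> // x _; exists (Num.truncn `|x|)%N => //.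
    by rewrite -ball_normE /ball_/= sub0r normrN truncnS_gt.
  apply: measure_negligible.
    by apply: bigcupT_measurable => k; exact: measurable_ball_rV.
  apply: negligible_bigcup => k; apply/negligibleP; first exact: measurable_ball_rV.
  exact: ballE.
have := null_set_integral measurableT measurable_phi lambda0.
by rewrite [LHS]int_phi => /eqP; rewrite eqe oner_eq0.
Qed.
End normal_law.

(** * Weak convergence and continuously converging integrands *)

Lemma bounded_fun_bound (R : realType) (T : Type) (g : T -> R) :
  bounded_fun g <-> exists C, forall x, `|g x| <= C.
Proof.
split=> [[M [_ gM]]|[C gC]].
  by exists (`|M| + 1) => x; apply: gM => //; rewrite ltr_pwDr// ler_norm.
exists C; split; first exact: num_real.
by move=> y /ltW Cy x _; exact: le_trans (gC x) Cy.
Qed.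

Section unit_mass.
Context d (T : measurableType d) (R : realType) (P : {measure set T -> \bar R}).
Hypothesis P1 : P setT = 1%E.

Lemma unit_mass_integrable (g : T -> R) (C : R) :
  measurable_fun setT g -> (forall x, `|g x| <= C) ->
  P.-integrable setT (EFin \o g).
Proof.
move=> mg gC; apply: measurable_bounded_integrable => //.
  by rewrite P1 ltry.
by apply/bounded_fun_bound; exists C.
Qed.

Lemma unit_mass_Rintegral_cst (c : R) : \int[P]_x c = c.
Proof. by rewrite Rintegral_cst// P1 mulr1. Qed.

Lemma unit_mass_Rintegral_le (g : T -> R) (C : R) :
  measurable_fun setT g -> (forall x, `|g x| <= C) -> `|\int[P]_x g x| <= C.
Proof.
move=> mg gC; apply: le_trans (le_normr_Rintegral measurableT _) _.
  exact: unit_mass_integrable gC.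
rewrite -[leRHS]unit_mass_Rintegral_cst; apply: le_Rintegral => //.
- apply: (unit_mass_integrable (C := C)); first exact: measurableT_comp.
  by move=> y; rewrite normr_id.
- by apply: (unit_mass_integrable (C := `|C|)).
Qed.

Lemma EFin_Rintegral (g : T -> R) (C : R) :
  measurable_fun setT g -> (forall x, `|g x| <= C) ->
  (\int[P]_x g x)%:E = (\int[P]_x (g x)%:E)%E.
Proof.
move=> mg gC; rewrite fineK//; apply: integrable_fin_num => //.
exact: unit_mass_integrable gC.
Qed.

Lemma Rintegral_dist_le (g h e : T -> R) (C : R) :
  measurable_fun setT g -> measurable_fun setT h -> measurable_fun setT e ->
  (forall x, `|g x| <= C) -> (forall x, `|h x| <= C) -> (forall x, `|e x| <= C) ->
  (forall x, `|g x - h x| <= e x) ->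
  `|\int[P]_x g x - \int[P]_x h x| <= \int[P]_x e x.
Proof.
move=> mg mh me gC hC eC ghe.
have ig := unit_mass_integrable mg gC; have ih := unit_mass_integrable mh hC.
have ie := unit_mass_integrable me eC.
rewrite -RintegralB//.
have igh : P.-integrable setT (EFin \o (fun x => g x - h x)).
  by have := integrableB measurableT ig ih.
apply: le_trans (le_normr_Rintegral measurableT igh) _.
apply: le_Rintegral => //.
exact: integrable_norm igh.
Qed.

End unit_mass.

Section cutoff.
Context (R : realType) (k : nat).

(** A continuous interpolation between the indicators of the balls of radius [M]
    and [M + 1]. *)
Definition cutoff (M : R) (y : 'rV[R]_k) : R :=
  Num.max 0 (Num.min 1 (M + 1 - `|y|)).

Lemma continuous_cutoff M : continuous (cutoff M).
Proof.
move=> y.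
apply: (@continuous_max _ _ (cst 0) (fun y => Num.min 1 (M + 1 - `|y|))).
  exact: cst_continuous.
apply: (@continuous_min _ _ (cst 1) (fun y => M + 1 - `|y|)).
  exact: cst_continuous.
apply: (@continuousB _ _ _ (cst (M + 1)) (@Num.norm _ _)); last exact: norm_continuous.
exact: cst_continuous.
Qed.

Lemma cutoff_ge0 M y : 0 <= cutoff M y.
Proof. by rewrite le_max lexx. Qed.

Lemma cutoff_le1 M y : cutoff M y <= 1.
Proof. by rewrite ge_max ler01 ge_min lexx. Qed.

Lemma cutoff_eq1 M y : `|y| <= M -> cutoff M y = 1.
Proof.
move=> yM; rewrite /cutoff min_l; first by rewrite max_r ?ler01.
by rewrite -addrAC lerDr subr_ge0.
Qed.

Lemma cutoff_eq0 M y : M + 1 <= `|y| -> cutoff M y = 0.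
Proof.
by move=> yM; rewrite /cutoff max_l// ge_min subr_le0 yM orbT.
Qed.

Lemma cutoff_norm_le1 M y : `|cutoff M y| <= 1.
Proof. by rewrite ger0_norm ?cutoff_ge0 ?cutoff_le1. Qed.

Lemma measurable_cutoff M : measurable_fun setT (cutoff M).
Proof. by apply: continuous_measurable_rV; exact: continuous_cutoff. Qed.

(** Tightness of a single law, in terms of continuous test functions so that it
    passes to weakly convergent families. *)
Lemma cutoff_tight (mu : {measure set 'rV[R]_k -> \bar R}) (e : R) :
  mu setT = 1%E -> 0 < e -> exists M, 1 - e < \int[mu]_y cutoff M y.
Proof.
move=> mu1 e0; pose B (n : nat) := [set y : 'rV[R]_k | `|y| <= n%:R].
have mB n : measurable (B n).
  rewrite -[B n]setTI; apply: measurable_fun_le => //.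
  by apply: continuous_measurable_rV; exact: norm_continuous.
have : mu (B n) @[n --> \oo] --> mu (\bigcup_n B n).
  apply: nondecreasing_cvg_mu => //; first exact: bigcupT_measurable.
  move=> m n mn; apply/subsetPset => y; rewrite /B/= => /le_trans; apply.
  by rewrite ler_nat.
have -> : \bigcup_n B n = setT.
  apply/seteqP; split=> // y _; exists (Num.truncn `|y|).+1%N => //.
  by rewrite /B/= ltW// truncnS_gt.
rewrite mu1 => /fine_cvg/cvgr_gt/(_ (1 - e)).
rewrite ltrBlDr ltrDl => /(_ e0)[n _ /(_ n (leqnn n))/= Bn]; exists n%:R.
apply: lt_le_trans Bn _; rewrite -lee_fin fineK; last first.
  have BT : (mu (B n) <= mu setT)%E by apply: le_measure; rewrite ?inE.
  by rewrite ge0_fin_numE// (le_lt_trans BT)// mu1 ltry.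
rewrite (EFin_Rintegral mu1 (measurable_cutoff _) (cutoff_norm_le1 _)).
rewrite -[B n]setIT -integral_indic//; apply: ge0_le_integral => //.
- apply/measurable_EFinP; apply: measurable_indic; exact: mB.
- by apply/measurable_EFinP; exact: measurable_cutoff.
- move=> y _; rewrite lee_fin indicE; case: (boolP (y \in B n)) => [|_].
    by rewrite inE => By; rewrite cutoff_eq1.
  exact: cutoff_ge0.
Qed.

End cutoff.

Section extended_continuous_mapping.
Context (R : realType) (k : nat) (I : Type) (F : set_system I) {FF : Filter F}.
Context (dT : measure_display) (T : I -> measurableType dT)
  (P : forall i, {measure set (T i) -> \bar R}) (Y : forall i, T i -> 'rV[R]_k)
  (mu : {measure set 'rV[R]_k -> \bar R}).
Hypothesis mu1 : mu setT = 1%E.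
Arguments Y : clear implicits.
Hypothesis P1 : forall i, P i setT = 1%E.
Hypothesis mY : forall i, measurable_fun setT (Y i).
Hypothesis Y_cvg : forall g : 'rV[R]_k -> R, continuous g -> bounded_fun g ->
  \int[P i]_w g (Y i w) @[i --> F] --> \int[mu]_y g y.

(** The extended continuous mapping theorem. By compactness of balls, the local
    hypothesis gives uniform closeness of [phi i] and [phi0] on a large ball, while
    the mass of the laws of [Y i] outside of it is controlled by the limit law [mu]
    through a cutoff. The set [D i] is where [phi i] is meaningful; the variable
    [Y i] lives there. *)
Lemma cvg_integral_continuous_mapping (D : I -> set 'rV[R]_k)
    (phi : I -> 'rV[R]_k -> R) (phi0 : 'rV[R]_k -> R) (C : R) :
  (forall i w, D i (Y i w)) ->
  (forall i, measurable_fun setT (fun w => phi i (Y i w))) ->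
  (forall i y, `|phi i y| <= C) -> (forall y, `|phi0 y| <= C) ->
  continuous phi0 ->
  (forall u (e : R), 0 < e -> \forall v \near u & i \near F,
     D i v -> `|phi i v - phi0 u| < e) ->
  \int[P i]_w phi i (Y i w) @[i --> F] --> \int[mu]_y phi0 y.
Proof.
move=> DY mphi phiC phi0C cphi0 loc; apply/cvgrPdist_le => e e0.
have C0 : 0 <= C := le_trans (normr_ge0 _) (phi0C 0).
(* The total error is r + 2 C (r + r) + r: at most r on the large ball, 2 C times
   a tail mass at most 2 r outside of it, and r from weak convergence. *)
pose A := 4 * C + 2.
have A0 : 0 < A by rewrite /A; lra.
pose r := e / A; have r0 : 0 < r by rewrite divr_gt0.
have [M cM] := cutoff_tight mu1 r0.
have bc : bounded_fun (@cutoff R k M).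
  by apply/bounded_fun_bound; exists 1; exact: cutoff_norm_le1.
have bphi0 : bounded_fun phi0 by apply/bounded_fun_bound; exists C.
have unif : \forall i \near F, [set y : 'rV[R]_k | `|y| <= M + 1] `<=`
    [set y | D i y -> `|phi i y - phi0 y| < r].
  have K : compact [set y : 'rV[R]_k | `|y| <= M + 1].
    apply: bounded_closed_compact.
      by exists (M + 1); split; [exact: num_real|move=> x /ltW Mx y /le_trans; apply].
    rewrite -[X in closed X]/((@Num.norm _ 'rV[R]_k) @^-1` [set x | x <= M + 1]).
    by apply: (preimage_closed _ (@closed_le _ _)) => y _; exact: norm_continuous.
  move/compact_near_coveringP : K =>
    /(_ _ _ (fun i y => D i y -> `|phi i y - phi0 y| < r)).
  apply => u _.
  have r20 : 0 < r / 2 by rewrite divr_gt0.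
  have [[U J] [/= uU FJ] UJ] := loc u _ r20.
  have uV : \forall v \near u, `|phi0 u - phi0 v| < r / 2.
    by have /cvgrPdist_lt := cphi0 u; apply.
  exists (U `&` [set v | `|phi0 u - phi0 v| < r / 2], J).
    by split=> //=; exact: filterI.
  move=> [v i] [/= [Uv vV] Ji] Dv.
  rewrite (le_lt_trans (ler_distD (phi0 u) _ _))// [r]splitr ltrD//.
  exact: (UJ (v, i)).
have tail : \forall i \near F, 1 - r - r < \int[P i]_w cutoff M (Y i w).
  have /cvgr_gt := Y_cvg (@continuous_cutoff R k M) bc; apply; lra.
have /cvgrPdist_le/(_ _ r0) close := Y_cvg cphi0 bphi0.
near=> i.
have mphi0 : measurable_fun setT (phi0 \o Y i).
  by apply: measurableT_comp => //; exact: continuous_measurable_rV.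
have mcut : measurable_fun setT (@cutoff R k M \o Y i).
  by apply: measurableT_comp => //; exact: measurable_cutoff.
have cutC := @cutoff_norm_le1 R k M.
have errC w : `|r + 2 * C * (1 - cutoff M (Y i w))| <= r + 2 * C + C.
  have := cutoff_ge0 M (Y i w); have := cutoff_le1 M (Y i w) => c1 c0.
  have h1 : 0 <= C * (1 - cutoff M (Y i w)) by rewrite mulr_ge0// subr_ge0.
  have h2 : 0 <= C * cutoff M (Y i w) by rewrite mulr_ge0.
  by rewrite ger0_norm; lra.
have merr : measurable_fun setT (fun w => r + 2 * C * (1 - cutoff M (Y i w))).
  by apply: measurable_funD => //; apply: measurable_funM => //; exact: measurable_funB.
have big (c : R) : `|c| <= C -> `|c| <= r + 2 * C + C by move=> ?; lra.
have := @Rintegral_dist_le _ _ _ (P i) (P1 i) (fun w => phi i (Y i w)) (phi0 \o Y i)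
  (fun w => r + 2 * C * (1 - cutoff M (Y i w))) (r + 2 * C + C) (mphi i) mphi0 merr
  (fun w => big _ (phiC i _)) (fun w => big _ (phi0C _)) errC.
have ptw w : `|phi i (Y i w) - (phi0 \o Y i) w| <=
    r + 2 * C * (1 - cutoff M (Y i w)).
  have [yM|yM] := leP `|Y i w| (M + 1).
    have unif_i : [set y | `|y| <= M + 1] `<=`
      [set y | D i y -> `|phi i y - phi0 y| < r] by near: i.
    rewrite (le_trans (ltW (unif_i _ yM (DY i w))))// lerDl.
    by rewrite !mulr_ge0// subr_ge0 cutoff_le1.
  rewrite cutoff_eq0 ?ltW//=.
  have := ler_normB (phi i (Y i w)) (phi0 (Y i w)).
  have := phiC i (Y i w); have := phi0C (Y i w); lra.
move=> /(_ ptw).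
have -> : \int[P i]_w (r + 2 * C * (1 - cutoff M (Y i w))) =
    r + 2 * C * (1 - \int[P i]_w cutoff M (Y i w)).
  have icut := unit_mass_integrable (P1 i) mcut (fun w => cutC _).
  have i1 : (P i).-integrable setT (EFin \o cst (1 : R)).
    by apply: (unit_mass_integrable (P1 i) (C := 1)) => // w; rewrite normr1.
  have isub : (P i).-integrable setT (EFin \o (fun w => 1 - cutoff M (Y i w))).
    by have := integrableB measurableT i1 icut.
  rewrite RintegralD//.
  - by rewrite RintegralZl// RintegralB// !unit_mass_Rintegral_cst.
  - by apply: (@unit_mass_integrable _ _ _ _ (P1 i) (cst r) `|r|).
  - by have := integrableZl measurableT (2 * C) isub.
have ti : 1 - r - r < \int[P i]_w cutoff M (Y i w) by near: i.
have ci : `|\int[mu]_y phi0 y - \int[P i]_w phi0 (Y i w)| <= r by near: i.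
move=> H; rewrite (le_trans (ler_distD (\int[P i]_w phi0 (Y i w)) _ _))//.
rewrite [X in _ + X]distrC.
have -> : e = r + (r + 2 * C * (r + r)).
  have : e = r * A by rewrite /r divfK ?gt_eqF.
  by rewrite /A; lra.
rewrite lerD// (le_trans H)// lerD2l ler_wpM2l ?mulr_ge0//; lra.
Unshelve. all: by end_near. Qed.
End extended_continuous_mapping.

(** * Conditional laws and translated integrands *)

Lemma power_measure_setT d (T : measurableType d) (R : realType)
    (mu : {sigma_finite_measure set T -> \bar R}) n :
  mu setT = 1%E -> power_measure mu n setT = 1%E.
Proof.
move=> mu1; elim: n => [|n IH]; first by rewrite /= diracT.
have E m : (power_measure mu m setT = \int[power_measure mu m]_t (cst 1 t))%E.
  by rewrite integral_cst// mul1e.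
rewrite E integral_power_measureS//.
transitivity (\int[mu]_x (cst 1 x))%E; last by rewrite integral_cst// mul1e.
by apply: eq_integral => x _; rewrite integral_cst// mul1e; exact: IH.
Qed.

Lemma iid_law_setT (R : realType) d n (g : 'rV[R]_d -> R) :
  iid_law n g setT = 1%E.
Proof. by apply: power_measure_setT; exact: probability_setT. Qed.

(** Adding the bound [C] makes a bounded function nonnegative; this transfers
    identities from nonnegative to bounded functions. *)
Lemma unit_mass_integral_shift d (T : measurableType d) (R : realType)
    (P : {measure set T -> \bar R}) (g : T -> R) (C : R) :
  P setT = 1%E -> measurable_fun setT g -> (forall x, `|g x| <= C) ->
  (\int[P]_x (g x + C)%:E = (\int[P]_x g x + C)%:E)%E.
Proof.
move=> P1 mg gC; have C0 x : 0 <= C := le_trans (normr_ge0 _) (gC x).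
rewrite EFinD (EFin_Rintegral P1 mg gC).
have ig := unit_mass_integrable P1 mg gC.
have iC : P.-integrable setT (EFin \o cst C).
  by apply: (unit_mass_integrable P1 (C := `|C|)).
have := integralD measurableT ig iC => /= ->; congr (_ + _)%E.
by rewrite integral_cst// P1 mule1.
Qed.

Lemma Rintegral_mixture d1 d2 (X : measurableType d1) (Y : measurableType d2)
    (R : realType) (nu : {measure set X -> \bar R})
    (mu : {measure set Y -> \bar R}) (k : X -> {measure set Y -> \bar R})
    (h : Y -> R) (C : R) :
  nu setT = 1%E -> mu setT = 1%E -> (forall x, k x setT = 1%E) ->
  (forall A, measurable A -> measurable_fun setT (k ^~ A)) ->
  (forall A, measurable A -> mu A = (\int[nu]_x k x A)%E) ->
  measurable_fun setT h -> (forall y, `|h y| <= C) ->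
  measurable_fun setT (fun x => \int[k x]_y h y) /\
  \int[mu]_y h y = \int[nu]_x \int[k x]_y h y.
Proof.
move=> nu1 mu1 k1 mk muE mh hC.
have hC0 y : (0 <= (h y + C)%:E)%E.
  by have := hC y; rewrite lee_fin ler_norml => /andP[? _]; lra.
have mhC : measurable_fun setT (fun y => (h y + C)%:E).
  by apply/measurable_EFinP; exact: measurable_funD.
have mkh : measurable_fun setT (fun x => \int[k x]_y h y).
  have := measurable_fun_integral_kernel mk hC0 mhC.
  under eq_fun do rewrite (unit_mass_integral_shift (k1 _) mh hC).
  move=> /measurable_EFinP mkhC.
  rewrite (_ : (fun _ => _) = (fun x => (\int[k x]_y h y + C) - C)).
    exact: measurable_funB.
  by apply/funext => x; rewrite addrK.
split => //.
have khC x : `|\int[k x]_y h y| <= C by exact: unit_mass_Rintegral_le hC.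
have := integral_mixture mk muE mhC hC0.
rewrite (unit_mass_integral_shift mu1 mh hC).
under [in X in _ = X -> _]eq_integral do
  rewrite (unit_mass_integral_shift (k1 _) mh hC).
by rewrite (unit_mass_integral_shift nu1 mkh khC) => -[/addIr].
Qed.

Lemma continuous_translate (R : realType) k (g : 'rV[R]_k -> R)
    (y u : 'rV[R]_k) (e : R) :
  continuous g -> 0 < e ->
  \forall y' \near y & v \near u, `|g (y' + v) - g (y + u)| < e.
Proof.
move=> cg e0.
have add_cvg : (z.1 + z.2 : 'rV[R]_k) @[z --> (nbhs y, nbhs u)] --> y + u.
  by apply: cvgD; [exact: cvg_fst|exact: cvg_snd].
have /cvgrPdistC_lt/(_ _ e0) := cvg_comp _ _ add_cvg (cg (y + u)).
exact.
Qed.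

Lemma translate_continuous (R : realType) k (g : 'rV[R]_k -> R) (u : 'rV[R]_k) :
  continuous g -> continuous (fun y : 'rV[R]_k => g (y + u)).
Proof.
by move=> cg y; apply: continuous_comp; [exact: cvgD cvg_id (cvg_cst _)|exact: cg].
Qed.

(** The translates of a continuous function converge locally uniformly, so the
    extended continuous mapping theorem applies to the constant family [mu]. *)
Lemma translate_integral_continuous (R : realType) k (g : 'rV[R]_k -> R)
    (mu : {measure set 'rV[R]_k -> \bar R}) :
  mu setT = 1%E -> continuous g -> bounded_fun g ->
  continuous (fun u => \int[mu]_y g (y + u)).
Proof.
move=> mu1 cg /bounded_fun_bound[C gC] u.
apply: (@cvg_integral_continuous_mapping _ _ _ (nbhs u) _ _ (fun=> 'rV[R]_k)
  (fun=> mu) (fun=> id) mu _ _ _ _ (fun=> setT)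
  (fun v y : 'rV[R]_k => g (y + v)) _ C) => //.
- by move=> h _ _; exact: cvg_cst.
- by move=> v; apply: continuous_measurable_rV; exact: translate_continuous.
- exact: translate_continuous.
- by move=> y e e0; have := continuous_translate y u cg e0; apply: filterS.
Qed.

(** * The normal law against bounded continuous functions *)

Section normal_law_bounded.
Context (R : realType) (n : nat) (S : 'M[R]_n).
Hypothesis S_unit : S \in unitmx.
Notation N := (normal_rV 0 S).
Notation N2 := (normal_rV 0 (2 *: S)).
Hypothesis N1 : N setT = 1%E.

Lemma normal_rV_double_setT : N2 setT = 1%E.
Proof.
have E (m : {measure set 'rV[R]_n -> \bar R}) :
    (\int[m]_t (cst 1%E t) = m setT)%E by rewrite integral_cst// mul1e.
rewrite -E -(normal_rV_convolution S_unit N1 (h := cst 1%E)); [|by []|by []].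
transitivity (\int[N]_x (cst 1%E x))%E; last by rewrite E; exact: N1.
by apply: eq_integral => u _; rewrite [LHS]E; exact: N1.
Qed.

Lemma Rintegral_normal_rV_convolution (g : 'rV[R]_n -> R) :
  continuous g -> bounded_fun g ->
  \int[N]_u \int[N]_y g (y + u) = \int[N2]_y g y.
Proof.
move=> cg bg; have [C gC] := (bounded_fun_bound g).1 bg.
have mg := continuous_measurable_rV cg.
have mgu (u : 'rV[R]_n) := continuous_measurable_rV (translate_continuous (u := u) cg).
have mI := continuous_measurable_rV (translate_integral_continuous N1 cg bg).
have IC u : `|\int[N]_y g (y + u)| <= C.
  exact: (unit_mass_Rintegral_le N1 (mgu u) (fun=> gC _)).
pose h (y : 'rV[R]_n) := (g y + C)%:E.
have mh : measurable_fun setT h by apply/measurable_EFinP; exact: measurable_funD.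
have h0 y : (0 <= h y)%E.
  by have := gC y; rewrite lee_fin ler_norml => /andP[? _]; lra.
have E1 : (\int[N]_u \int[N]_y h (y + u)%R =
    (\int[N]_u \int[N]_y g (y + u) + C)%:E)%E.
  apply: etrans (unit_mass_integral_shift N1 mI IC).
  apply: eq_integral => u _.
  exact: (unit_mass_integral_shift N1 (mgu u) (fun=> gC _)).
have E2 := unit_mass_integral_shift normal_rV_double_setT mg gC.
have E3 := etrans (etrans (esym E1) (normal_rV_convolution S_unit N1 mh h0)) E2.
exact: addIr (EFin_inj E3).
Qed.

Lemma Rintegral_normal_rV_scale (g : 'rV[R]_n -> R) :
  continuous g -> (forall y, 0 <= g y) ->
  \int[N2]_y g y = \int[N]_y g (Num.sqrt 2 *: y).
Proof.
move=> cg g0.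
have mg : measurable_fun setT (EFin \o g).
  by apply/measurable_EFinP; exact: continuous_measurable_rV.
have Eg0 y : (0 <= (EFin \o g) y)%E by rewrite /= lee_fin.
exact: (congr1 fine (normal_rV_scale S_unit mg Eg0)).
Qed.

Lemma Rintegral_normal_rV_gt0 (g : 'rV[R]_n -> R) (u : 'rV[R]_n) :
  continuous g -> bounded_fun g -> (forall x, 0 <= g x) -> 0 < g u ->
  0 < \int[N]_x g x.
Proof.
move=> cg /bounded_fun_bound[C gC] g0 gu.
rewrite -lte_fin (EFin_Rintegral N1 (continuous_measurable_rV cg) gC).
exact: normal_rV_support gu.
Qed.

End normal_law_bounded.

(** At step [n], choose a point of [D n] in the smallest of the first [n] balls of
    radius [k.+1^-1] that [D n] meets. *)
Lemma exists_cvg_selection (R : realType) (V : normedModType R)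
    (D : nat -> set V) (u : V) :
  (forall r : R, 0 < r -> \forall n \near \oo, exists2 v, D n v & ball u r v) ->
  exists2 h : nat -> V, h n @[n --> \oo] --> u & \forall n \near \oo, D n (h n).
Proof.
move=> Dball; pose r k : R := k.+1%:R^-1.
have r0 k : 0 < r k by rewrite invr_gt0.
have best n m : exists v, forall k, (k < m)%N ->
    (exists2 v, D n v & ball u (r k) v) -> D n v /\ ball u (r k) v.
  elim: m => [|m [v IH]]; first by exists u.
  have [[v' Dv' uv']|nex] := pselect (exists2 v, D n v & ball u (r m) v).
    exists v' => k; rewrite ltnS => km _; split=> //.
    by apply: le_ball uv'; rewrite lef_pV2 ?posrE// ler_nat ltnS.
  exists v => k; rewrite ltnS leq_eqVlt => /orP[/eqP->//|]; exact: IH.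
have /choice[h hP] n : exists v, forall k, (k < n)%N ->
  (exists2 v, D n v & ball u (r k) v) -> D n v /\ ball u (r k) v by exact: best.
exists h.
  apply/cvgrPdist_lt => e e0.
  have [k re] : exists k, r k < e.
    by have /filter_ex := near_infty_natSinv_lt (PosNum e0).
  have := Dball _ (r0 k); apply: filter_app; near=> n => Dn.
  have [|_] := hP n k _ Dn; first by near: n; exact: nbhs_infty_gt.
  by rewrite -ball_normE /ball_/= => /lt_trans; apply.
have := Dball _ (r0 0%N); apply: filter_app; near=> n => Dn.
by have [|] := hP n 0%N _ Dn; first by near: n; exact: nbhs_infty_gt.
Unshelve. all: by end_near. Qed.

(** * Locally uniform convergence of the means under nearby parameters *)

Section local_parameters.
Context (R : realType) (d p : nat) (Theta : set 'rV[R]_p)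
  (f : 'rV[R]_p -> 'rV[R]_d -> R)
  (est : forall n : nat, n.-tuple 'rV[R]_d -> 'rV[R]_p) (theta0 : 'rV[R]_p)
  (N : {measure set 'rV[R]_p -> \bar R}).
Hypothesis est_estimator : estimator Theta est.
Hypothesis N1 : N setT = 1%E.
(* [N] charges every open set, expressed with continuous functions. *)
Hypothesis N_support : forall (g : 'rV[R]_p -> R) u, continuous g -> bounded_fun g ->
  (forall x, 0 <= g x) -> 0 < g u -> 0 < \int[N]_x g x.
Hypothesis est_cvg : cvg_in_dist (fun n => iid_law n (f theta0))
  (fun n => @scaled_error R d p est n theta0) N.

Definition local_param (n : nat) (v : 'rV[R]_p) : 'rV[R]_p :=
  theta0 + (Num.sqrt n%:R)^-1 *: v.

Hypothesis est_local_cvg : forall (h : nat -> 'rV[R]_p) (u : 'rV[R]_p),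
  h n @[n --> \oo] --> u -> (\forall n \near \oo, Theta (local_param n (h n))) ->
  cvg_in_dist (fun n => iid_law n (f (local_param n (h n))))
    (fun n => @scaled_error R d p est n (local_param n (h n))) N.

Lemma measurable_scaled_error n theta :
  measurable_fun setT (@scaled_error R d p est n theta).
Proof.
have := measurable_rV_affine (Num.sqrt n%:R) (- (Num.sqrt n%:R *: theta)).
move=> /measurableT_comp/(_ (est_estimator n).1).
by apply: eq_measurable_fun => z _ /=; rewrite /scaled_error scalerBr.
Qed.

Lemma local_param_scaled_error n (z : n.-tuple 'rV[R]_d) : (0 < n)%N ->
  local_param n (scaled_error est theta0 z) = est z.
Proof.
move=> n0; rewrite /local_param scalerA mulVf ?scale1r ?subrKC//.
by rewrite gt_eqF// sqrtr_gt0 ltr0n.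
Qed.

Lemma scaled_error_local_param n (v : 'rV[R]_p) (z : n.-tuple 'rV[R]_d) :
  (0 < n)%N ->
  scaled_error est (local_param n v) z + v = scaled_error est theta0 z.
Proof.
move=> n0; rewrite /scaled_error /local_param opprD addrA scalerBr scalerA.
by rewrite mulfV ?scale1r ?subrK// gt_eqF// sqrtr_gt0 ltr0n.
Qed.

(** The parameter set may be arbitrarily thin, but the estimator takes its values
    in it and its scaled error has a limit law charging every ball, so the local
    parameter sets come close to every point. *)
Lemma local_param_dense (u : 'rV[R]_p) (r : R) : 0 < r ->
  \forall n \near \oo, exists2 v, Theta (local_param n v) & ball u r v.
Proof.
move=> r0; pose psi (y : 'rV[R]_p) := Num.max 0 (r - `|y - u|).
have psi0 y : 0 <= psi y by rewrite le_max lexx.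
have psic : continuous psi.
  have sub_cvg (y : 'rV[R]_p) : (y' - u @[y' --> y] --> y - u).
    exact: cvgB cvg_id (cvg_cst _).
  have norm_cvg : continuous (fun y : 'rV[R]_p => `|y - u|).
    by move=> y; exact: cvg_norm (sub_cvg y).
  move=> y.
  apply: (@continuous_max _ _ (cst 0) (fun y : 'rV[R]_p => r - `|y - u|)).
    exact: cst_continuous.
  apply: (@continuousB _ _ _ (cst r) (fun y : 'rV[R]_p => `|y - u|)).
    exact: cst_continuous.
  exact: norm_cvg.
have psib : bounded_fun psi.
  apply/bounded_fun_bound; exists r => y.
  by rewrite ger0_norm// ge_max ltW//= gerBl.
have psiu : 0 < psi u by rewrite /psi subrr normr0 subr0 lt_max r0 orbT.
have /cvgr_gt/(_ _ (N_support psic psib psi0 psiu)) := est_cvg psic psib.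
apply: filter_app; near=> n => psi_gt0.
apply/not_exists2P => noD; move: psi_gt0; rewrite ltNge => /negP; apply.
rewrite le_eqVlt; apply/orP; left; apply/eqP; rewrite /Rintegral.
rewrite integral0_eq// => z _; congr EFin; rewrite /psi max_l// subr_le0.
have n0 : (0 < n)%N by near: n; exact: nbhs_infty_gt.
have [|] := noD (scaled_error est theta0 z).
  by rewrite local_param_scaled_error//; move/(_ ((est_estimator n).2 z)).
by rewrite -ball_normE /ball_/= distrC => /negP; rewrite -leNgt.
Unshelve. all: by end_near. Qed.

Variables (g : 'rV[R]_p -> R) (cg : continuous g) (bg : bounded_fun g).

(** The conditional mean of [g] at the scaled error of the resampled data, given
    that the scaled error of the original data is [v]. *)
Definition local_mean (n : nat) (v : 'rV[R]_p) : R :=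
  \int[iid_law n (f (local_param n v))]_z g (scaled_error est theta0 z).

(** Under the local parameter [h n] the error with respect to [theta0] is the error
    with respect to the true parameter, which converges to [N], shifted by [h n];
    the extended continuous mapping theorem absorbs the moving shift. *)
Lemma local_mean_cvg (h : nat -> 'rV[R]_p) (u : 'rV[R]_p) :
  h n @[n --> \oo] --> u -> (\forall n \near \oo, Theta (local_param n (h n))) ->
  local_mean n (h n) @[n --> \oo] --> \int[N]_y g (y + u).
Proof.
move=> hu hT; have [C gC] := (bounded_fun_bound g).1 bg.
have mgT (v : 'rV[R]_p) :=
  continuous_measurable_rV (translate_continuous (u := v) cg).
have := @cvg_integral_continuous_mapping R p nat \oo _ _ _
  (fun n => iid_law n (f (local_param n (h n))))
  (fun n => @scaled_error R d p est n (local_param n (h n))) N N1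
  (fun n => iid_law_setT _ _) (fun n => measurable_scaled_error _)
  (est_local_cvg hu hT) (fun=> setT) (fun n y => g (y + h n)) (fun y => g (y + u)) C
  (fun _ _ => I) (fun n => measurableT_comp (mgT (h n)) (measurable_scaled_error _))
  (fun n y => gC _) (fun y => gC _) (translate_continuous (u := u) cg).
have loc (y : 'rV[R]_p) (e : R) : 0 < e -> \forall y' \near y & n \near \oo,
    [set: 'rV[R]_p] y' -> `|g (y' + h n) - g (y + u)| < e.
  move=> e0; have [[A B] [/= yA uB] AB] := continuous_translate y u cg e0.
  exists (A, [set n | B (h n)]); first by split => //=; exact: hu.
  by move=> [y' n] [/= Ay' Bn] _; exact: (AB (y', h n)).
move=> /(_ _ loc); apply: cvg_trans; apply: near_eq_cvg; near=> n.
have n0 : (0 < n)%N by near: n; exact: nbhs_infty_gt.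
by apply: eq_Rintegral => z _; rewrite scaled_error_local_param.
Unshelve. all: by end_near. Qed.

(** Equivariance speaks of full sequences of local parameters. A failure of local
    uniformity only yields a subsequence of bad parameters converging to [u]; the
    missing indices are filled by a sequence of admissible parameters tending to
    [u], which exists by density, and the resulting full sequence contradicts
    equivariance. *)
Lemma local_mean_cvg_locally (u : 'rV[R]_p) (e : R) : 0 < e ->
  \forall v \near u & n \near \oo, Theta (local_param n v) ->
    `|local_mean n v - \int[N]_y g (y + u)| < e.
Proof.
move=> e0; apply: contrapT => nloc; pose r k : R := k.+1%:R^-1.
have r0 k : 0 < r k by rewrite invr_gt0.
have /choice[nv nvP] k : exists nv : nat * 'rV[R]_p,
    [/\ (k <= nv.1)%N, ball u (r k) nv.2, Theta (local_param nv.1 nv.2) &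
      e <= `|local_mean nv.1 nv.2 - \int[N]_y g (y + u)|].
  apply: contrapT => nbad; apply: nloc; exists (ball u (r k), [set n | (k <= n)%N]).
    by split => /=; [exact/nbhsx_ballx/r0|exact: nbhs_infty_ge].
  move=> [v n] [/= uv kn] Tv; rewrite ltNge; apply/negP => bad.
  by apply: nbad; exists (n, v).
have [h hu hT] := exists_cvg_selection (local_param_dense u).
pose h' n := if pselect (exists k, (nv k).1 = n) is left ex
  then (nv (projT1 (cid ex))).2 else h n.
have h'P n : (h' n = h n /\ ~ exists k, (nv k).1 = n) \/
    exists2 k, (nv k).1 = n & h' n = (nv k).2.
  rewrite /h'; case: pselect => [ex|nex]; last by left; split.
  by right; exists (projT1 (cid ex)) => //; exact: projT2 (cid ex).
have h'T : \forall n \near \oo, Theta (local_param n (h' n)).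
  apply: filterS hT => n hTn; have [[->]//|[k <- ->]] := h'P n.
  by have [] := nvP k.
(* Each index [k] produces one bad step [(nv k).1], so that beyond the first [k]
   of these steps only bad parameters of index at least [k] occur. *)
have h'u : h' n @[n --> \oo] --> u.
  apply/cvgrPdist_lt => a a0.
  have [k ra] : exists k, r k < a.
    by have /filter_ex := near_infty_natSinv_lt (PosNum a0).
  have /cvgrPdist_lt/(_ _ a0) := hu; apply: filter_app; near=> n => hn.
  have [[->]//|[j jn ->]] := h'P n.
  have kj : (k <= j)%N.
    rewrite leqNgt; apply/negP => jk.
    have : (\max_(i < k) (nv i).1 < n)%N by near: n; exact: nbhs_infty_gt.
    by rewrite ltnNge -jn (leq_bigmax (Ordinal jk)).
  have [_ + _ _] := nvP j; rewrite -ball_normE /ball_/= => /lt_trans; apply.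
  by apply: le_lt_trans ra; rewrite lef_pV2 ?posrE// ler_nat ltnS.
have /cvgrPdistC_lt/(_ _ e0)[n0 _ n0P] := local_mean_cvg h'u h'T.
have [k0 _ _ _] := nvP n0.
have := n0P _ k0; have [[_ []]|[k kn ->]] := h'P (nv n0).1; first by exists n0.
by have [_ _ _] := nvP k; rewrite kn leNgt => /negP.
Unshelve. all: by end_near. Qed.
End local_parameters.

(** * Separating the two laws by the mass of a ball *)

Lemma Rintegral_pushforward d1 d2 (X : measurableType d1) (Y : measurableType d2)
    (R : realType) (P : {measure set X -> \bar R}) (mu : {measure set Y -> \bar R})
    (phi : X -> Y) (h : Y -> R) (C : R) :
  P setT = 1%E -> measurable_fun setT phi ->
  (forall A, measurable A -> mu A = P (phi @^-1` A)) ->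
  measurable_fun setT h -> (forall y, `|h y| <= C) ->
  \int[mu]_y h y = \int[P]_x h (phi x).
Proof.
move=> P1 mphi muE mh hC.
have mu1 : mu setT = 1%E by rewrite muE.
have mk A : measurable A -> measurable_fun setT (fun x => \d_(phi x) A : \bar R).
  move=> mA; rewrite /dirac; apply/measurable_EFinP.
  exact: measurableT_comp (measurable_indic mA) mphi.
have muE' A : measurable A -> mu A = (\int[P]_x \d_(phi x) A)%E.
  move=> mA; have mpA : measurable (phi @^-1` A).
    by rewrite -[X in measurable X]setTI; exact: mphi.
  by rewrite muE// -[X in P X]setIT -integral_indic.
have [_ ->] := @Rintegral_mixture _ _ _ _ R P mu (fun x => \d_(phi x)) h C P1
   mu1 (fun x => diracT _ _) mk muE' mh hC.
apply: eq_Rintegral => x _.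
by rewrite /Rintegral integral_dirac ?diracT ?mul1e//; exact/measurable_EFinP.
Qed.

Section cutoff_prob.
Context d (T : measurableType d) (R : realType) (k : nat) (P : probability T R)
  (Y : T -> 'rV[R]_k).
Hypothesis mY : measurable_fun setT Y.

Lemma measurable_norm_le (M : R) : measurable [set w | `|Y w| <= M].
Proof.
rewrite -[X in measurable X]setTI; apply: measurable_fun_le => //.
apply: measurableT_comp mY; apply: continuous_measurable_rV.
exact: norm_continuous.
Qed.

Let mcut M : measurable_fun setT (fun w => cutoff M (Y w)).
Proof. exact: measurableT_comp (measurable_cutoff _) mY. Qed.

Let probE (M : R) :
  P [set w | `|Y w| <= M] = (\int[P]_w (\1_[set w | `|Y w| <= M] w)%:E)%E.
Proof. by rewrite integral_indic ?setIT//; exact: measurable_norm_le. Qed.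

Lemma cutoff_le_prob (M : R) :
  ((\int[P]_w cutoff M (Y w))%:E <= P [set w | (`|Y w| <= M + 1)%R])%E.
Proof.
rewrite (EFin_Rintegral (probability_setT P) (mcut M) (fun=> cutoff_norm_le1 _ _)).
rewrite probE; apply: ge0_le_integral => //.
- by move=> w _; rewrite lee_fin cutoff_ge0.
- exact/measurable_EFinP.
- by apply/measurable_EFinP; exact: measurable_indic (measurable_norm_le _).
- move=> w _; rewrite lee_fin indicE; case: (boolP (_ \in _)) => [_|].
    exact: cutoff_le1.
  by rewrite notin_setE /= => /negP; rewrite -ltNge => /ltW/cutoff_eq0 ->.
Qed.

Lemma prob_le_cutoff (M : R) :
  (P [set w | (`|Y w| <= M)%R] <= (\int[P]_w cutoff M (Y w))%:E)%E.
Proof.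
rewrite (EFin_Rintegral (probability_setT P) (mcut M) (fun=> cutoff_norm_le1 _ _)).
rewrite probE; apply: ge0_le_integral => //.
- by apply/measurable_EFinP; exact: measurable_indic (measurable_norm_le _).
- exact/measurable_EFinP.
- move=> w _; rewrite lee_fin indicE; case: (boolP (_ \in _)) => [|_].
    by rewrite inE /= => YM; rewrite cutoff_eq1.
  exact: cutoff_ge0.
Qed.

End cutoff_prob.

Lemma sqrt2_ge (R : rcfType) : 7 / 5 <= Num.sqrt 2 :> R.
Proof.
by rewrite -ler_sqr ?nnegrE ?sqrtr_ge0 ?divr_ge0// sqr_sqrtr// expr2; lra.
Qed.

(** The mass near the origin decreases when the covariance doubles. After
    dilation, the two cutoffs compare pointwise: the dilated one vanishes for
    [5 <= `|y|] because [6 + 1 <= 5 * sqrt 2], while the other equals 1 for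
    [`|y| <= 5]. *)
Lemma cutoff_normal_rV_lt (R : realType) p (S : 'M[R]_p) :
  (0 < p)%N -> S \in unitmx -> normal_rV 0 S setT = 1%E ->
  \int[normal_rV 0 (2 *: S)]_y cutoff 6 y < \int[normal_rV 0 S]_y cutoff 5 y.
Proof.
move=> p0 S_unit N1.
have cc M := @continuous_cutoff R p M.
pose s2 : R := Num.sqrt 2.
have s2_75 : 7 / 5 <= s2 := sqrt2_ge R.
have cs : continuous (fun y : 'rV[R]_p => cutoff 6 (s2 *: y)).
  by move=> y; apply: continuous_comp (cc 6 _); exact: scaler_continuous.
pose g (y : 'rV[R]_p) := cutoff 5 y - cutoff 6 (s2 *: y).
have cg : continuous g.
  move=> y.
  by apply: (@continuousB _ _ _ (cutoff 5) (fun y => cutoff 6 (s2 *: y)));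
    [exact: cc|exact: cs].
have far (y : 'rV[R]_p) : 5 <= `|y| -> cutoff 6 (s2 *: y) = 0.
  move=> y5; apply: cutoff_eq0; rewrite normrZ ger0_norm ?sqrtr_ge0//.
  have : (7 / 5) * 5 <= s2 * `|y| by rewrite ler_pM.
  lra.
have g0 y : 0 <= g y.
  rewrite subr_ge0; have [y5|/ltW y5] := leP `|y| 5.
    by rewrite (cutoff_eq1 y5) cutoff_le1.
  by rewrite far// cutoff_ge0.
have bg : bounded_fun g.
  apply/bounded_fun_bound; exists 1 => y; rewrite ger0_norm//.
  by rewrite (le_trans _ (cutoff_le1 5 y))// gerBl cutoff_ge0.
pose e : 'rV[R]_p := const_mx 1.
have e0 : e != 0.
  by apply/eqP => /rowP/(_ (Ordinal p0)); rewrite !mxE => /eqP; rewrite oner_eq0.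
pose u := (5 / `|e|) *: e.
have nu : `|u| = 5.
  by rewrite normrZ ger0_norm ?divr_ge0// divfK// normr_eq0.
have gu : 0 < g u by rewrite /g cutoff_eq1 ?nu// far ?nu// subr0.
have i5 := unit_mass_integrable N1 (measurable_cutoff 5) (cutoff_norm_le1 5).
have i6 := unit_mass_integrable N1 (continuous_measurable_rV cs)
  (fun y => cutoff_norm_le1 6 _).
have lt56 := Rintegral_normal_rV_gt0 N1 cg bg g0 gu.
rewrite (RintegralB measurableT i5 i6) subr_gt0 in lt56.
have scaleE := Rintegral_normal_rV_scale S_unit (cc 6) (cutoff_ge0 6).
exact: (eq_ind_r (fun x => x < _) lt56 scaleE).
Qed.

(** * Efficiency and equivariance of the resampled estimator *)

(** Testing against the constant 1; the infinite mass is excluded because [fine]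
    sends it to 0. *)
Lemma cvg_in_dist_setT (R : realType) k (dT : measure_display)
    (T : nat -> measurableType dT) (P : forall n, {measure set (T n) -> \bar R})
    (Y : forall n, T n -> 'rV[R]_k) (nu : {measure set 'rV[R]_k -> \bar R}) :
  (forall n, P n setT = 1%E) -> cvg_in_dist P Y nu -> nu setT = 1%E.
Proof.
move=> P1 Y_cvg.
have c1 : continuous (cst 1 : 'rV[R]_k -> R).
  by move=> y; apply: (@cst_continuous _ _ (1 : R)).
have b1 : bounded_fun (cst 1 : 'rV[R]_k -> R).
  by apply/bounded_fun_bound; exists 1 => ?; rewrite normr1.
have := Y_cvg _ c1 b1; rewrite Rintegral_cst// mul1r.
have -> : (fun n => \int[P n]_w cst 1 (Y n w)) = cst 1.
  by apply/funext => n; exact: unit_mass_Rintegral_cst.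
move=> /(cvg_unique (@Rhausdorff R) (cvg_cst _)).
by case: (nu setT) => [r /= ->|/= /eqP|/= /eqP]; rewrite ?oner_eq0.
Qed.

Lemma cond_iid_sample_Rintegral (R : realType) (d p : nat) (dO : measure_display)
    (Omega : measurableType dO) (P : probability Omega R) (n : nat)
    (f : 'rV[R]_p -> 'rV[R]_d -> R) (T : Omega -> 'rV[R]_p)
    (Z : {RV P >-> n.-tuple 'rV[R]_d}) (h : n.-tuple 'rV[R]_d -> R) (C : R) :
  measurable_fun setT T -> cond_iid_sample P f T Z ->
  measurable_fun setT h -> (forall z, `|h z| <= C) ->
  measurable_fun setT (fun w => \int[iid_law n (f (T w))]_z h z) /\
  \int[P]_w h (Z w) = \int[P]_w \int[iid_law n (f (T w))]_z h z.
Proof.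
move=> mT ZP mh hC.
have mk A : measurable A -> measurable_fun setT (fun w => iid_law n (f (T w)) A).
  move=> mA _ B mB; have [B' mB' E] := (ZP A mA).1 measurableT B mB.
  by rewrite -E; exact: mT.
have muE A : measurable A ->
    distribution P Z A = (\int[P]_w iid_law n (f (T w)) A)%E.
  move=> mA; have := (ZP A mA).2 setT measurableT.
  by rewrite preimage_setT setTI.
have [mI <-] := @Rintegral_mixture _ _ _ _ R P (distribution P Z)
  (fun w => iid_law n (f (T w))) h C (probability_setT P) (probability_setT _)
  (fun w => iid_law_setT _ _) mk muE mh hC.
split=> //.
apply/esym/(Rintegral_pushforward (probability_setT P) _ _ mh hC) => //.
Qed.

(** The event that [Y] lies in the ball of radius [M + 1] is squeezed between the
    two cutoffs. *)
Lemma cutoff_gap_le_tv d (T : measurableType d) (R : realType) k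
    (mu nu : probability T R) (Y : T -> 'rV[R]_k) (M : R) :
  measurable_fun setT Y ->
  ((\int[mu]_x cutoff M (Y x) - \int[nu]_x cutoff (M + 1) (Y x))%:E
    <= tv_dist mu nu)%E.
Proof.
move=> mY; pose A := [set x | `|Y x| <= M + 1].
have mA : measurable A by exact: measurable_norm_le.
apply: (@le_trans _ _ `|mu A - nu A|%E); last first.
  by apply: ereal_sup_ubound; exists A.
apply: le_trans (lee_abs _); rewrite EFinB; apply: leeB.
  exact: cutoff_le_prob.
exact: prob_le_cutoff.
Qed.

Theorem theorem1 (R : realType) (d p : nat) (p_gt0 : (0 < p)%N)
    (Theta : set 'rV[R]_p) (f : 'rV[R]_p -> 'rV[R]_d -> R)
    (f_density : forall theta, Theta theta -> is_density (f theta))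
    (theta0 : 'rV[R]_p) (theta0_Theta : Theta theta0)
    (f_fisher : has_fisher f theta0)
    (est : forall n : nat, n.-tuple 'rV[R]_d -> 'rV[R]_p)
    (est_estimator : estimator Theta est)
    (est_efficient : efficient f est theta0)
    (est_lae : lae Theta f est theta0)
    (dO : measure_display) (Omega : nat -> measurableType dO)
    (P : forall n, probability (Omega n) R)
    (X Z : forall n, {RV (P n) >-> n.-tuple 'rV[R]_d})
    (X_iid : forall n, iid_sample (P n) (X n) (f theta0))
    (Z_iid : forall n, cond_iid_sample (P n) f (@est n \o X n) (Z n)) :
  (cvg_in_dist P (fun n w => scaled_error est theta0 (Z n w))
     (normal_rV 0 (2 *: invmx (fisher f theta0))) /\
   cvg_in_dist P (fun n w => scaled_error est theta0 (X n w))
     (normal_rV 0 (invmx (fisher f theta0)))) /\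
  ~ (tv_dist (distribution (P n) (X n)) (distribution (P n) (Z n))
       @[n --> \oo] --> 0%E).

Proof.
pose N := normal_rV 0 (invmx (fisher f theta0)).
have S_unit : invmx (fisher f theta0) \in unitmx.
  by rewrite unitmx_inv; case: f_fisher.
(* The normalisation of the normal density comes from efficiency, by testing
   against the constant 1. *)
have N1 : N setT = 1%E.
  exact: cvg_in_dist_setT (fun n => iid_law_setT n (f theta0)) est_efficient.
have [H H_cvg H_local_cvg] := est_lae.
have HN g : continuous g -> bounded_fun g -> \int[H]_y g y = \int[N]_y g y.
  move=> cg bg.
  have H1 := H_cvg _ cg bg; have H2 := est_efficient _ cg bg.
  exact: (cvg_unique (@Rhausdorff R) H1 H2).
have local_cvg (h : nat -> 'rV[R]_p) (u : 'rV[R]_p) : h n @[n --> \oo] --> u ->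
    (\forall n \near \oo, Theta (local_param theta0 n (h n))) ->
    cvg_in_dist (fun n => iid_law n (f (local_param theta0 n (h n))))
      (fun n => @scaled_error R d p est n (local_param theta0 n (h n))) N.
  by move=> hu hT g cg bg; rewrite -HN//; exact: H_local_cvg hu hT g cg bg.
have N_support (g : 'rV[R]_p -> R) (u : 'rV[R]_p) :=
  @Rintegral_normal_rV_gt0 R p _ N1 g u.
have mse n := measurable_scaled_error est_estimator theta0 (n := n).
have XE n (h : n.-tuple 'rV[R]_d -> R) C : measurable_fun setT h ->
    (forall z, `|h z| <= C) ->
    \int[P n]_w h (X n w) = \int[iid_law n (f theta0)]_z h z.
  move=> mh hC.
  apply/esym/(Rintegral_pushforward (probability_setT (P n)) _ _ mh hC) => //.
  by move=> A mA; exact: esym (X_iid n A mA).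
have X_cvg : cvg_in_dist P (fun n w => scaled_error est theta0 (X n w)) N.
  move=> g cg bg; have [C gC] := (bounded_fun_bound g).1 bg.
  have mg := continuous_measurable_rV cg.
  under eq_cvg do rewrite (XE _ _ _ (measurableT_comp mg (mse _)) (fun=> gC _)).
  exact: est_efficient.
have Z_cvg : cvg_in_dist P (fun n w => scaled_error est theta0 (Z n w))
    (normal_rV 0 (2 *: invmx (fisher f theta0))).
  move=> g cg bg; have [C gC] := (bounded_fun_bound g).1 bg.
  have mg := continuous_measurable_rV cg.
  have meX n : measurable_fun setT (@est n \o X n).
    by apply: measurableT_comp => //; exact: (est_estimator n).1.
  have Zint n := cond_iid_sample_Rintegral (meX n) (Z_iid n)
    (measurableT_comp mg (mse n)) (fun=> gC _).
  rewrite -(Rintegral_normal_rV_convolution S_unit N1 cg bg).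
  (* At [n = 0] the scaling factor and its inverse are both 0, so the local
     parameter is [theta0] instead of the estimate. *)
  have U_local n w : Theta (local_param theta0 n (scaled_error est theta0 (X n w))).
    case: n w => [|n] w; last first.
      by rewrite local_param_scaled_error//; exact: (est_estimator n.+1).2.
    by rewrite /local_param sqrtr0 invr0 scale0r addr0.
  have mean_measurable n : measurable_fun setT (fun w =>
      local_mean f est theta0 g n (scaled_error est theta0 (X n w))).
    case: n => [|n].
      rewrite (_ : (fun w => _) = cst (local_mean f est theta0 g 0 0)).
        exact: measurable_cst.
      by apply/funext => w; rewrite /local_mean /local_param sqrtr0 invr0 !scale0r.
    have [mI _] := Zint n.+1; apply: eq_measurable_fun mI => w _.
    by rewrite /local_mean local_param_scaled_error.
  have mean_le n v : `|local_mean f est theta0 g n v| <= C.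
    exact: (unit_mass_Rintegral_le (iid_law_setT _ _)
      (measurableT_comp mg (mse n)) (fun=> gC _)).
  have trans_le u : `|\int[N]_y g (y + u)| <= C.
    apply: (unit_mass_Rintegral_le N1 _ (fun=> gC _)).
    exact: continuous_measurable_rV (translate_continuous cg).
  have mean_cvg := cvg_integral_continuous_mapping N1 (fun n => probability_setT (P n))
    (fun n => measurableT_comp (mse n) (measurable_funP (X n))) X_cvg
    U_local mean_measurable mean_le trans_le
    (translate_integral_continuous N1 cg bg)
    (local_mean_cvg_locally est_estimator N1 N_support est_efficient local_cvg cg bg).
  apply: cvg_trans (mean_cvg _); apply: near_eq_cvg; near=> n.
  have n0 : (0 < n)%N by near: n; exact: nbhs_infty_gt.
  have [_ ->] := Zint n; apply: eq_Rintegral => w _.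
  by rewrite /local_mean local_param_scaled_error.
split=> [|tv0]; first exact: (conj Z_cvg X_cvg).
have cutb M : bounded_fun (@cutoff R p M).
  by apply/bounded_fun_bound; exists 1; exact: cutoff_norm_le1.
have gap_gt0 := cutoff_normal_rV_lt p_gt0 S_unit N1.
rewrite -subr_gt0 in gap_gt0.
have X5 := X_cvg _ (@continuous_cutoff _ _ 5) (cutb 5).
have Z6 := Z_cvg _ (@continuous_cutoff _ _ 6) (cutb 6).
have /(_ _)/cvgr_gt gap_near := cvgB X5 Z6.
have tv_small (e : R) : 0 < e -> \forall n \near \oo,
    (tv_dist (distribution (P n) (X n)) (distribution (P n) (Z n)) < e%:E)%E.
  move=> e0; have oe : nbhs (0 : \bar R)%E (fun x => (x < e%:E)%E).
    by apply: open_ereal_lt'; rewrite lte_fin.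
  exact: tv0 _ oe.
move: (_ - _) gap_gt0 gap_near => gap gap_gt0 gap_near.
have half_lt : gap / 2 < gap by rewrite ltr_pdivrMr// ltr_pMr// ltr1n.
have half_gt0 : 0 < gap / 2 by rewrite divr_gt0.
have [n [gap_n tv_n]] :=
  filter_ex (filterI (gap_near _ half_lt) (tv_small _ half_gt0)).
have cut_le M y := @cutoff_norm_le1 R p M y.
have mcut M : measurable_fun setT (cutoff M \o @scaled_error R d p est n theta0).
  exact: measurableT_comp (measurable_cutoff M) (mse n).
have distE (V : {RV (P n) >-> n.-tuple 'rV[R]_d}) M :
    \int[distribution (P n) V]_z cutoff M (scaled_error est theta0 z) =
    \int[P n]_w cutoff M (scaled_error est theta0 (V w)).
  by apply: (Rintegral_pushforward (probability_setT (P n)) _ _ (mcut M)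
    (fun=> cut_le _ _)).
have := cutoff_gap_le_tv (distribution (P n) (X n)) (distribution (P n) (Z n))
  5 (mse n).
rewrite !distE (_ : 5 + 1 = 6); last by ring.
move=> /le_lt_trans/(_ tv_n); rewrite lte_fin => /(lt_trans gap_n).
by rewrite ltxx.
Unshelve. all: by end_near. Qed.
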